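(* Let $R$ be an associative ring with identity. The following assertions are equivalent: (1) $R$ is an $IF$-ring. (2) Any left $R$-module embeds in a flat module. (3) Any pure-projective left $R$-module embeds in a flat module. (4) Any finitely presented left $R$-module embeds in a flat module. (5) For any flat right $R$-module $F$, $F^+$ is flat. (6) For any injective left $R$-module $E$ and any submodule $N$ of $E$, if $N$ is injective then $E/N$ is flat. (7) For any injective left $R$-module $E$ and any submodule $N$ of $E$, if $N$ is $FP$-injective then $E/N$ is flat. (8) There exists an f-rugged left $R$-module that embeds in a flat module.
   Context: Modules are unital left $R$-modules unless stated otherwise. $R$ is an $IF$-ring if every injective left $R$-module is flat. $F^+=\mathrm{Hom}_{\mathbb{Z}}(F,\mathbb{Q}/\mathbb{Z})$ is the character module. A module $N$ is $FP$-injective if $\mathrm{Ext}^1(F,N)=0$ for every finitely presented module $F$. A flat precover of a module $N$ is a morphism $g:F\to N$ with $F$ flat such that $\mathrm{Hom}(F',F)\to\mathrm{Hom}(F',N)$ is surjective for every flat module $F'$. The flat-precover completing domain $\mathfrak{F}^{-1}(M)$ is the class of all modules $N$ such that for every morphism $f:M\to N$ and every flat precover $g:F\to N$ there is a morphism $h:M\to F$ with $gh=f$. A module $M$ is f-rugged if $\mathfrak{F}^{-1}(M)$ is as small as possible, i.e. consists exactly of the flat modules. *)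

(* Defs.v *)
From HB Require Import structures.
From mathcomp Require Import all_boot all_order all_algebra.
From mathcomp Require Import generic_quotient ring_quotient boolp functions.
Set Implicit Arguments.
Unset Strict Implicit.
Unset Printing Implicit Defensive.
Import GRing.Theory.
Local Open Scope ring_scope.
Local Open Scope quotient_scope.

(* Rings are [pzRingType]s: the zero ring is allowed.  A left R-module is an
   [lmodType R]; a right R-module is an [lmodType R^c] over the converse ring,
   the right action of r on x being [(r : R^c) *: x]. *)

Definition surjective_map (A B : Type) (f : A -> B) : Prop :=
  forall y, exists x, f x = y.

Section Tensor.
Variables (R : pzRingType) (A : lmodType R^c) (M : lmodType R).
Implicit Types (a : A) (m : M) (r : R) (s t u : seq (A * M)).

(* [:: (a1, m1); ...; (an, mn)] stands for the formal sum of the ai (x) mi.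
   No formal negatives are needed, since - (a (x) m) = (- a) (x) m. *)
Inductive tensor_eq : seq (A * M) -> seq (A * M) -> Prop :=
| Teq_refl s : tensor_eq s s
| Teq_sym s t : tensor_eq s t -> tensor_eq t s
| Teq_trans s t u : tensor_eq s t -> tensor_eq t u -> tensor_eq s u
| Teq_cat s s' t t' :
    tensor_eq s s' -> tensor_eq t t' -> tensor_eq (s ++ t) (s' ++ t')
| Teq_catC s t : tensor_eq (s ++ t) (t ++ s)
| Teq_0l m : tensor_eq [:: (0, m)] [::]
| Teq_Dl a a' m : tensor_eq [:: (a + a', m)] [:: (a, m); (a', m)]
| Teq_Dr a m m' : tensor_eq [:: (a, m + m')] [:: (a, m); (a, m')]
| Teq_bal r a m : tensor_eq [:: ((r : R^c) *: a, m)] [:: (a, r *: m)].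

Definition tensor_rel : rel (seq (A * M)) := fun s t => `[< tensor_eq s t >].

Lemma tensor_rel_equiv : equiv_class_of tensor_rel.
Proof.
split=> [s|s t|t s u]; first by apply/asboolP; exact: Teq_refl.
  by apply/asboolP/asboolP; exact: Teq_sym.
by move=> /asboolP st /asboolP tu; apply/asboolP; exact: Teq_trans st tu.
Qed.

Canonical tensor_rel_equivRel := EquivRelPack tensor_rel_equiv.
Canonical tensor_rel_encModRel := defaultEncModRel tensor_rel.

Definition tensor := {eq_quot tensor_rel}.

HB.instance Definition _ : EqQuotient _ tensor_rel tensor :=
  EqQuotient.on tensor.
HB.instance Definition _ := Choice.on tensor.

Lemma tensorP s t : reflect (tensor_eq s t) (s == t %[mod tensor]).
Proof. by rewrite piE; exact: asboolP. Qed.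

Lemma tensor_eqP s t : \pi_tensor s = \pi_tensor t <-> tensor_eq s t.
Proof. by split=> [/eqP/tensorP|/tensorP/eqP]. Qed.

Definition tensor_oppT s : seq (A * M) := [seq (- p.1, p.2) | p <- s].

Lemma tensor_addN s : tensor_eq (tensor_oppT s ++ s) [::].
Proof.
elim: s => [|[a m] s IHs]; first exact: Teq_refl.
apply: (@Teq_trans _ ([:: (- a, m); (a, m)] ++ (tensor_oppT s ++ s))).
  have -> : tensor_oppT ((a, m) :: s) ++ (a, m) :: s
      = [:: (- a, m)] ++ ((tensor_oppT s ++ [:: (a, m)]) ++ s).
    by rewrite -catA.
  apply: (@Teq_cat [:: (- a, m)] [:: (- a, m)] _
    (([:: (a, m)] ++ tensor_oppT s) ++ s)).
    exact: Teq_refl.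
  by apply: Teq_cat; [exact: Teq_catC | exact: Teq_refl].
rewrite -[X in tensor_eq _ X]cat0s; apply: Teq_cat IHs.
apply: Teq_trans (Teq_0l m); apply: Teq_sym; rewrite -[X in (X, _)](addNr a).
exact: Teq_Dl.
Qed.

Lemma tensor_oppT_eq s t :
  tensor_eq s t -> tensor_eq (tensor_oppT s) (tensor_oppT t).
Proof.
move=> st; rewrite -[tensor_oppT s]cats0.
apply: Teq_trans (_ : tensor_eq (tensor_oppT s ++ (s ++ tensor_oppT t)) _).
  apply: Teq_cat; first exact: Teq_refl.
  apply: Teq_trans (_ : tensor_eq (tensor_oppT t ++ t) _).
    by apply: Teq_sym; exact: tensor_addN.
  apply: Teq_trans (Teq_catC _ _) _.
  by apply: Teq_cat; [exact: Teq_sym | exact: Teq_refl].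
rewrite catA -[X in tensor_eq _ X]cat0s.
by apply: Teq_cat; [exact: tensor_addN | exact: Teq_refl].
Qed.

Definition tensor_zero : tensor := \pi_tensor [::].
Definition tensor_add (x y : tensor) : tensor := \pi_tensor (repr x ++ repr y).
Definition tensor_opp (x : tensor) : tensor :=
  \pi_tensor (tensor_oppT (repr x)).

Lemma tensor_repr s : tensor_eq (repr (\pi_tensor s)) s.
Proof. by apply/tensor_eqP; rewrite reprK. Qed.

Lemma tensor_addE s t :
  tensor_add (\pi_tensor s) (\pi_tensor t) = \pi_tensor (s ++ t).
Proof. by apply/tensor_eqP/Teq_cat; exact: tensor_repr. Qed.

Lemma tensor_oppE s : tensor_opp (\pi_tensor s) = \pi_tensor (tensor_oppT s).
Proof. by apply/tensor_eqP/tensor_oppT_eq/tensor_repr. Qed.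

Lemma tensor_addA : associative tensor_add.
Proof.
elim/quotW=> s; elim/quotW=> t; elim/quotW=> u.
by rewrite (tensor_addE t u) (tensor_addE s t) !tensor_addE catA.
Qed.

Lemma tensor_addC : commutative tensor_add.
Proof. by move=> x y; apply/tensor_eqP/Teq_catC. Qed.

Lemma tensor_add0 : left_id tensor_zero tensor_add.
Proof. by move=> x; rewrite -[x]reprK tensor_addE. Qed.

Lemma tensor_addNx : left_inverse tensor_zero tensor_opp tensor_add.
Proof.
move=> x; rewrite -[x]reprK tensor_oppE tensor_addE.
by apply/tensor_eqP/tensor_addN.
Qed.

HB.instance Definition _ := GRing.isZmodule.Build tensor
  tensor_addA tensor_addC tensor_add0 tensor_addNx.

Definition pure_tensor a m : tensor := \pi_tensor [:: (a, m)].

Lemma tensor_sumE s :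
  \pi_tensor s = \sum_(p <- s) pure_tensor p.1 p.2.
Proof.
elim: s => [|[a m] s IHs]; first by rewrite big_nil.
by rewrite big_cons -IHs /= -[RHS]/(tensor_add _ _) tensor_addE.
Qed.

Definition balanced (G : zmodType) (b : A -> M -> G) : Prop :=
  [/\ forall a a' m, b (a + a') m = b a m + b a' m,
      forall a m m', b a (m + m') = b a m + b a m'
    & forall (r : R) a m, b ((r : R^c) *: a) m = b a (r *: m)].

Lemma pure_tensor_balanced : balanced pure_tensor.
Proof.
have E (s : seq (A * M)) (a : A) (m : M) :
    pure_tensor a m + \pi_tensor s = \pi_tensor ((a, m) :: s).
  by rewrite -[LHS]/(tensor_add _ _) tensor_addE.
split=> *; rewrite ?E; apply/tensor_eqP.
- exact: Teq_Dl.
- exact: Teq_Dr.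
exact: Teq_bal.
Qed.

Lemma tensor_universal (G : zmodType) (b : A -> M -> G) : balanced b ->
  exists2 f : {additive tensor -> G},
    forall a m, f (pure_tensor a m) = b a m
  & forall g : {additive tensor -> G},
      (forall a m, g (pure_tensor a m) = b a m) -> g =1 f.
Proof.
move=> [bDl bDr bZ].
pose ev (s : seq (A * M)) := \sum_(p <- s) b p.1 p.2.
have evP s t : tensor_eq s t -> ev s = ev t.
  rewrite /ev; elim=> {s t} [//|//|s t u _ -> _ -> //|s s' t t' _ IHs _ IHt
    |s t|m|a a' m|a m m'|r a m]; rewrite ?big_cat ?big_cons ?big_nil /= ?addr0.
  - by rewrite IHs IHt.
  - exact: addrC.
  - by apply: (addrI (b 0 m)); rewrite -bDl !addr0.
  - exact: bDl.
  - exact: bDr.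
  - exact: bZ.
pose f (x : tensor) := ev (repr x).
have fE s : f (\pi_tensor s) = ev s by apply/evP/tensor_repr.
have f_add : nmod_morphism f.
  split; first by rewrite -[0]/(\pi_tensor [::]) fE /ev big_nil.
  move=> x y; rewrite -[x]reprK -[y]reprK -[_ + _]/(tensor_add _ _).
  by rewrite tensor_addE !fE /ev big_cat.
pose F : {additive tensor -> G} :=
  HB.pack f (GRing.isNmodMorphism.Build _ _ f f_add).
exists F => [a m|g gE x]; first by rewrite /= fE /ev big_seq1.
rewrite -[x]reprK tensor_sumE !raddf_sum; apply: eq_bigr => p _.
by rewrite gE /= fE /ev big_seq1.
Qed.

End Tensor.

Section TensorMap.
Variables (R : pzRingType) (A B : lmodType R^c) (M N : lmodType R).
Variables (f : {linear A -> B}) (g : {linear M -> N}).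

Definition tensor_map (x : tensor A M) : tensor B N :=
  \pi_(tensor B N) [seq (f p.1, g p.2) | p <- repr x].

Lemma tensor_map_eq (s t : seq (A * M)) : tensor_eq s t ->
  tensor_eq [seq (f p.1, g p.2) | p <- s] [seq (f p.1, g p.2) | p <- t].
Proof.
elim=> {s t}
  [s|s t _|s t u _ + _|s s' t t' _ IHs _ IHt|s t|m|a a' m|a m m'|r a m];
  rewrite ?map_cat /= ?linear0 ?linearD ?linearZ.
- exact: Teq_refl.
- exact: Teq_sym.
- exact: Teq_trans.
- exact: Teq_cat.
- exact: Teq_catC.
- exact: Teq_0l.
- exact: Teq_Dl.
- exact: Teq_Dr.
- exact: Teq_bal.
Qed.

Lemma tensor_mapE (s : seq (A * M)) :
  tensor_map (\pi s) = \pi_(tensor B N) [seq (f p.1, g p.2) | p <- s].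
Proof. by apply/tensor_eqP/tensor_map_eq/tensor_repr. Qed.

Lemma tensor_map_pure a m :
  tensor_map (pure_tensor a m) = pure_tensor (f a) (g m).
Proof. by rewrite tensor_mapE. Qed.

Lemma tensor_map_is_additive : nmod_morphism tensor_map.
Proof.
split; first by rewrite -[0]/(\pi_(tensor A M) [::]) tensor_mapE.
move=> x y; rewrite -[x]reprK -[y]reprK -[_ + _]/(tensor_add _ _).
by rewrite tensor_addE !tensor_mapE map_cat -tensor_addE.
Qed.

HB.instance Definition _ := GRing.isNmodMorphism.Build
  (tensor A M) (tensor B N) tensor_map tensor_map_is_additive.

End TensorMap.

Section Submodule.
Variables (R : pzRingType) (E : lmodType R) (N : submodClosed E).

Record submod := Submod {submod_val : E; _ : submod_val \in N}.

HB.instance Definition _ := [isSub for submod_val].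
HB.instance Definition _ := [Choice of submod by <:].
HB.instance Definition _ := [SubChoice_isSubLmodule of submod by <:].

(* The library quotient [{quot _}] is by a [zmodClosed] predicate, an instance
   that [submodClosed] does not carry. *)
Definition submod_pred : {pred E} := fun x => x \in N.

Lemma submod_pred_closed : zmod_closed submod_pred.
Proof.
split=> [|x y Nx Ny]; rewrite /submod_pred unfold_in; first exact: rpred0.
by apply: rpredD => //; rewrite -scaleN1r; exact: rpredZ.
Qed.

HB.instance Definition _ := GRing.isZmodClosed.Build E submod_pred
  submod_pred_closed.

Definition quotmod := Quotient.quot submod_pred.

HB.instance Definition _ := EqQuotient.on quotmod.
HB.instance Definition _ := GRing.Zmodule.on quotmod.

Definition quotmod_scale (r : R) (x : quotmod) : quotmod :=
  \pi_quotmod (r *: repr x).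

Lemma quotmod_eqP (x y : E) : \pi_quotmod x = \pi_quotmod y <-> x - y \in N.
Proof.
rewrite -[x - y \in N]/(x - y \in submod_pred) Quotient.idealrBE.
by split=> /eqP.
Qed.

Lemma quotmod_scaleE r x : quotmod_scale r (\pi x) = \pi_quotmod (r *: x).
Proof.
apply/quotmod_eqP; rewrite -scalerBr; apply: rpredZ.
by apply/quotmod_eqP; rewrite reprK.
Qed.

Lemma quotmod_addE x y : \pi_quotmod (x + y) = \pi x + \pi y.
Proof. exact: Quotient.pi_add. Qed.

Fact quotmod_scaleA a b x :
  quotmod_scale a (quotmod_scale b x) = quotmod_scale (a * b) x.
Proof. by rewrite -[x]reprK !quotmod_scaleE scalerA. Qed.

Fact quotmod_scale1 : left_id 1 quotmod_scale.
Proof. by move=> x; rewrite -[x]reprK quotmod_scaleE scale1r. Qed.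

Fact quotmod_scaleDr : right_distributive quotmod_scale +%R.
Proof.
move=> a x y; rewrite -[x]reprK -[y]reprK -quotmod_addE !quotmod_scaleE.
by rewrite scalerDr quotmod_addE.
Qed.

Fact quotmod_scaleDl x : {morph quotmod_scale^~ x : a b / a + b}.
Proof.
move=> a b /=; rewrite -[x]reprK !quotmod_scaleE.
by rewrite scalerDl quotmod_addE.
Qed.

HB.instance Definition _ := GRing.Zmodule_isLmodule.Build R quotmod
  quotmod_scaleA quotmod_scale1 quotmod_scaleDr quotmod_scaleDl.

End Submodule.

Definition rat_int : {pred rat} := fun x => x \is a Num.int.

Lemma rat_int_closed : zmod_closed rat_int.
Proof. by split=> [|x y]; [exact: rpred0 | exact: rpredB]. Qed.

HB.instance Definition _ := GRing.isZmodClosed.Build rat rat_int rat_int_closed.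

Definition QmodZ : zmodType := Quotient.quot rat_int.

Section CharacterModule.
Variables (R : pzRingType) (F : lmodType R^c).

Definition char_pred : {pred F -> QmodZ} :=
  fun f => `[< {morph f : x y / x + y} >].

Record char_module := CharModule
  {char_val :> F -> QmodZ; _ : char_val \in char_pred}.

Lemma char_pred_closed : zmod_closed char_pred.
Proof.
split=> [|f g /asboolP fD /asboolP gD]; apply/asboolP => x y.
  by rewrite /= addr0.
rewrite -[LHS]/(f (x + y) - g (x + y)) fD gD -[RHS]/(f x - g x + (f y - g y)).
by rewrite opprD addrACA.
Qed.

HB.instance Definition _ := GRing.isZmodClosed.Build (F -> QmodZ) char_pred
  char_pred_closed.
HB.instance Definition _ := [isSub for char_val].
HB.instance Definition _ := [Choice of char_module by <:].
HB.instance Definition _ := [SubChoice_isSubZmodule of char_module by <:].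

Lemma char_scale_proof (r : R) (phi : char_module) :
  (fun x => phi ((r : R^c) *: x)) \in char_pred.
Proof.
apply/asboolP => x y; rewrite scalerDr.
by case: phi => f /= /asboolP ->.
Qed.

Definition char_scale (r : R) (phi : char_module) : char_module :=
  CharModule (char_scale_proof r phi).

Lemma char_moduleP (f g : char_module) : f =1 g -> f = g.
Proof. by move=> fg; apply/val_inj/funext. Qed.

Fact char_scaleA a b phi :
  char_scale a (char_scale b phi) = char_scale (a * b) phi.
Proof. by apply: char_moduleP => x /=; rewrite scalerA. Qed.

Fact char_scale1 : left_id 1 char_scale.
Proof. by move=> phi; apply: char_moduleP => x /=; rewrite scale1r. Qed.

Fact char_scaleDr : right_distributive char_scale +%R.
Proof. by move=> a f g; apply: char_moduleP. Qed.

Fact char_scaleDl phi : {morph char_scale^~ phi : a b / a + b}.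
Proof.
move=> a b; apply: char_moduleP => x; rewrite /= scalerDl.
case: phi => f /= /asboolP fD; exact: fD.
Qed.

HB.instance Definition _ := GRing.Zmodule_isLmodule.Build R char_module
  char_scaleA char_scale1 char_scaleDr char_scaleDl.

End CharacterModule.

Section ModuleNotions.
Variable R : pzRingType.
Implicit Types A B C E F M N P : lmodType R.

Definition exact_at A B C (f : {linear A -> B}) (g : {linear B -> C}) : Prop :=
  forall y, g y = 0 <-> exists x, f x = y.

Definition short_exact A B C
    (i : {linear A -> B}) (p : {linear B -> C}) : Prop :=
  [/\ injective i, exact_at i p & surjective_map p].

Definition flat M : Prop :=
  forall (A B : lmodType R^c) (i : {linear A -> B}), injective i ->
    injective (tensor_map i (idfun : {linear M -> M})).

Definition flat_right (X : lmodType R^c) : Prop :=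
  forall A B (i : {linear A -> B}), injective i ->
    injective (tensor_map (idfun : {linear X -> X}) i).

Definition injective_module E : Prop :=
  forall A B (i : {linear A -> B}), injective i ->
  forall f : {linear A -> E}, exists h : {linear B -> E}, h \o i =1 f.

Definition projective_module P : Prop :=
  forall B C (p : {linear B -> C}), surjective_map p ->
  forall f : {linear P -> C}, exists h : {linear P -> B}, p \o h =1 f.

Definition finitely_presented M : Prop :=
  exists m n (d : {linear 'rV[R]_m -> 'rV[R]_n}) (p : {linear 'rV[R]_n -> M}),
    exact_at d p /\ surjective_map p.

Definition pure A B (i : {linear A -> B}) : Prop :=
  forall X : lmodType R^c, injective (tensor_map (idfun : {linear X -> X}) i).

Definition pure_projective P : Prop :=
  forall A B C (i : {linear A -> B}) (p : {linear B -> C}),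
    short_exact i p -> pure i ->
  forall f : {linear P -> C}, exists h : {linear P -> B}, p \o h =1 f.

(* Ext^1(M, N) = 0: the complex Hom(P_0, N) -> Hom(P_1, N) -> Hom(P_2, N)
   obtained from a projective resolution of M is exact in the middle.  Only the
   terms of the resolution in degrees at most 2 matter. *)
Definition Ext1_eq0 M N : Prop :=
  forall P2 P1 P0 (d2 : {linear P2 -> P1}) (d1 : {linear P1 -> P0})
      (e : {linear P0 -> M}),
    projective_module P2 -> projective_module P1 -> projective_module P0 ->
    exact_at d2 d1 -> exact_at d1 e -> surjective_map e ->
  forall f : {linear P1 -> N}, (forall x, f (d2 x) = 0) ->
  exists h : {linear P0 -> N}, h \o d1 =1 f.

Definition FP_injective N : Prop :=
  forall F, finitely_presented F -> Ext1_eq0 F N.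

Definition embeds_in_flat M : Prop :=
  exists F (i : {linear M -> F}), flat F /\ injective i.

Definition flat_precover F N (g : {linear F -> N}) : Prop :=
  flat F /\
  forall F', flat F' ->
  forall f : {linear F' -> N}, exists h : {linear F' -> F}, g \o h =1 f.

Definition flat_precover_completing_domain M N : Prop :=
  forall (f : {linear M -> N}) F (g : {linear F -> N}), flat_precover g ->
  exists h : {linear M -> F}, g \o h =1 f.

Definition f_rugged M : Prop :=
  forall N, flat_precover_completing_domain M N <-> flat N.

End ModuleNotions.

Definition IF_ring (R : pzRingType) : Prop :=
  forall E : lmodType R, injective_module E -> flat E.

(* Main.v *)
(* Flatness of a module and purity of a submodule are read off finite systems of
   linear equations.  A module whose maps from finitely presented modules factor
   through flat modules is flat; applied to an injective module [E], this gives
   (4) => (1), since every map to [E] extends along an embedding in a flat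
   module.  (5) enters because [F^+] is injective for flat [F] and every
   injective module is a summand of [F^+] for some free [F], and (7) because an
   FP-injective submodule is pure, a quotient of a flat module by a pure
   submodule being flat.

   For (8) one needs that every module [N] has a flat precover.  Given [F -> N]
   with [F] flat, divide [F] by a maximal pure submodule of the kernel.  The
   quotient is flat, and no nonzero pure submodule of it is killed by the map to
   [N]; this forces every element of the quotient to be named by a term from a
   type that only depends on [N].  Hence a set of flat modules suffices to build
   the precover as a direct sum.  A module having every finitely presented
   module as a summand is then f-rugged. *)
Require Import Defs.
From HB Require Import structures.
From mathcomp Require Import all_boot all_order all_algebra.
From mathcomp Require Import generic_quotient ring_quotient.
From mathcomp Require Import boolp classical_sets functions.
Set Implicit Arguments.
Unset Strict Implicit.
Unset Printing Implicit Defensive.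
Import Order.TTheory GRing.Theory Num.Theory.
Local Open Scope ring_scope.
Local Open Scope quotient_scope.
Local Open Scope classical_set_scope.

(** * Linear maps, submodules and systems of equations *)

Definition additive_of (A B : zmodType) (f : A -> B) (f_add : zmod_morphism f) :
    {additive A -> B} :=
  HB.pack f (GRing.isZmodMorphism.Build A B f f_add).

Section Basics.
Variable R : pzRingType.
Implicit Types A B C E F M N P : lmodType R.

Definition linear_of A B (f : A -> B) (f_lin : linear f) : {linear A -> B} :=
  HB.pack f (GRing.isLinear.Build R A B *:%R f f_lin).

Definition is_submod M (P : M -> Prop) : Prop :=
  P 0 /\ forall (r : R) x y, P x -> P y -> P (r *: x + y).

Section SubmodOf.
Variables (M : lmodType R) (P : M -> Prop) (Psub : is_submod P).

Let Q : {pred M} := fun x => `[< P x >].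

Fact submod_of_closed : GRing.submod_closed Q.
Proof.
case: Psub => P0 PD; split=> [|r x y /asboolP Px /asboolP Py]; apply/asboolP.
  exact: P0.
exact: PD.
Qed.

Definition submod_of : submodClosed M :=
  HB.pack Q (GRing.isSubmodClosed.Build R M Q submod_of_closed).

Lemma submod_ofP x : reflect (P x) (x \in submod_of).
Proof. exact: asboolP. Qed.

End SubmodOf.

Definition submod_incl M (N : submodClosed M) : {linear submod N -> M} :=
  linear_of (fun r x y => erefl : submod_val (r *: x + y) = _).

Lemma submod_incl_inj M (N : submodClosed M) : injective (@submod_incl M N).
Proof. exact: val_inj. Qed.

Definition quotmod_proj M (N : submodClosed M) : {linear M -> quotmod N}.
Proof.
apply: (@linear_of _ _ (fun x => \pi_(quotmod N) x)) => r x y.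
by rewrite quotmod_addE -quotmod_scaleE.
Defined.

Lemma quotmod_proj_eq0 M (N : submodClosed M) x :
  quotmod_proj N x = 0 <-> x \in N.
Proof.
rewrite -(linear0 (quotmod_proj N)).
by split=> [/quotmod_eqP|xN]; [|apply/quotmod_eqP]; rewrite subr0.
Qed.

Lemma quotmod_proj_surj M (N : submodClosed M) :
  surjective_map (quotmod_proj N).
Proof. by move=> x; exists (repr x); exact: reprK. Qed.

(** The chosen section [s] of [p] need not be linear, but [q \o s] is, since [q] does not see the
    choice. *)
Lemma linear_factor A B C (p : {linear A -> B}) (q : {linear A -> C}) :
  surjective_map p -> (forall x, p x = 0 -> q x = 0) ->
  exists h : {linear B -> C}, forall x, h (p x) = q x.
Proof.
move=> /choice[s sK] pq.
have q_s x : q (s (p x)) = q x.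
  by apply/eqP; rewrite -subr_eq0 -linearB; apply/eqP/pq;
    rewrite linearB sK subrr.
have h_lin : linear (q \o s).
  by move=> r x y /=; rewrite -linearP -[RHS]q_s linearP !sK.
by exists (linear_of h_lin).
Qed.

Lemma linear_lift A B C (i : {linear B -> C}) (f : {linear A -> C}) :
  injective i -> (forall x, exists y, i y = f x) ->
  exists h : {linear A -> B}, forall x, i (h x) = f x.
Proof.
move=> i_inj /choice[s sK].
have h_lin : linear s by move=> r x y; apply: i_inj;
    rewrite linearP !sK linearP.
by exists (linear_of h_lin).
Qed.

Lemma image_submod A B (f : {linear A -> B}) :
  is_submod (fun y => exists x, f x = y).
Proof.
split=> [|r _ _ [x <-] [x' <-]]; first by exists 0; rewrite linear0.
by exists (r *: x + x'); rewrite linearP.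
Qed.

Definition lin_image A B (f : {linear A -> B}) : submodClosed B :=
  submod_of (image_submod f).

Lemma image_factor A B (f : {linear A -> B}) :
  exists2 f' : {linear A -> submod (lin_image f)},
    (forall x, submod_incl (lin_image f) (f' x) = f x) & surjective_map f'.
Proof.
have [|f' f'E] := linear_lift (f := f) (@submod_incl_inj _ (lin_image f)).
  move=> x; have xi : f x \in lin_image f by apply/submod_ofP; exists x.
  by exists (Submod xi).
exists f' => // -[y yi]; have /submod_ofP[x xE] := yi; exists x.
by apply: submod_incl_inj; rewrite f'E.
Qed.

Definition rowmap n M (e : 'I_n -> M) (v : 'rV[R]_n) : M :=
  \sum_k v 0 k *: e k.

Lemma rowmap_linear n M (e : 'I_n -> M) : linear (rowmap e).
Proof.
move=> r x y; rewrite /rowmap scaler_sumr -big_split /=; apply: eq_bigr => k _.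
by rewrite !mxE scalerDl scalerA.
Qed.

Definition rowlin n M (e : 'I_n -> M) : {linear 'rV[R]_n -> M} :=
  linear_of (rowmap_linear e).

Lemma rowlinE n M (e : 'I_n -> M) v : rowlin e v = \sum_k v 0 k *: e k.
Proof. by []. Qed.

Lemma sum_deltaZ n M (e : 'I_n -> M) k :
  \sum_j ((k == j)%:R : R) *: e j = e k.
Proof.
rewrite (bigD1 k) //= eqxx scale1r big1 ?addr0 // => j /negPf.
by rewrite eq_sym => ->; rewrite scale0r.
Qed.

Lemma rowlin_delta n M (e : 'I_n -> M) k : rowlin e (delta_mx 0 k) = e k.
Proof.
by rewrite rowlinE -[RHS]sum_deltaZ; apply: eq_bigr => j _; rewrite !mxE eq_sym.
Qed.

Lemma row_decomp n (v : 'rV[R]_n) : v = \sum_k v 0 k *: delta_mx 0 k.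
Proof.
apply/matrixP => i j; rewrite ord1 summxE (bigD1 j) //= !mxE !eqxx mulr1.
by rewrite big1 ?addr0 // => k /negPf kj; rewrite !mxE eq_sym kj mulr0.
Qed.

Lemma linear_rowE n M (f : {linear 'rV[R]_n -> M}) v :
  f v = \sum_k v 0 k *: f (delta_mx 0 k).
Proof.
by rewrite {1}[v]row_decomp linear_sum; apply: eq_bigr => k _; rewrite linearZ.
Qed.

Lemma row_projective n : projective_module 'rV[R]_n.
Proof.
move=> B C p /choice[s sK] f;
  exists (rowlin (fun k => s (f (delta_mx 0 k)))) => v.
rewrite /= [RHS]linear_rowE linear_sum; apply: eq_bigr => k _.
by rewrite linearZ sK.
Qed.

(* Flatness and purity in terms of finite systems of linear equations [S x = c]
   with coefficient matrix [S] over [R]. *)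
Definition eq_flat M : Prop :=
  forall m l (S : 'I_m -> 'I_l -> R) (e : 'I_l -> M),
    (forall j, \sum_k S j k *: e k = 0) ->
  exists n (X : 'I_l -> 'I_n -> R) (y : 'I_n -> M),
    (forall k, e k = \sum_t X k t *: y t) /\
    (forall j t, \sum_k S j k * X k t = 0).

Definition eq_pure M (P : M -> Prop) : Prop :=
  forall m l (S : 'I_m -> 'I_l -> R) (b : 'I_l -> M),
    (forall j, P (\sum_k S j k *: b k)) ->
  exists a : 'I_l -> M, (forall k, P (a k)) /\
    (forall j, \sum_k S j k *: a k = \sum_k S j k *: b k).

Lemma linear_comb M N (f : {linear M -> N}) l (c : 'I_l -> R) (e : 'I_l -> M) :
  f (\sum_k c k *: e k) = \sum_k c k *: f (e k).
Proof. by rewrite linear_sum; apply: eq_bigr => k _; rewrite linearZ. Qed.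

(** A solution [e] in [N] lifts to some [b] with [S b] in the kernel of [p]. Purity gives [a] in the
    kernel with the same constants, so [b - a] is a solution in [M] above [e]. *)
Lemma eq_flat_pure_quotient M N (p : {linear M -> N}) : surjective_map p ->
  eq_flat M -> eq_pure (fun x => p x = 0) -> eq_flat N.
Proof.
move=> /choice[s sK] flM pup m l S e Se0; pose b k := s (e k).
have Sb0 j : p (\sum_k S j k *: b k) = 0.
  by rewrite linear_comb -[RHS](Se0 j); apply: eq_bigr => k _; rewrite sK.
have [a [pa0 Sa]] := pup _ _ S b Sb0.
have [j|n [X [y [yE SX]]]] := flM _ _ S (fun k => b k - a k).
  under eq_bigr do rewrite scalerBr.
  by rewrite sumrB Sa subrr.
exists n, X, (fun t => p (y t)); split=> // k.
by rewrite -linear_comb -yE linearB pa0 subr0 sK.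
Qed.

Lemma eq_flat_quot M (N : submodClosed M) :
  eq_flat M -> eq_pure (fun x => x \in N) -> eq_flat (quotmod N).
Proof.
move=> flM puN; apply: (eq_flat_pure_quotient (@quotmod_proj_surj M N)) => //.
move=> m l S b Sb; have [j|a [aN Sa]] := puN _ _ S b.
  exact/quotmod_proj_eq0.
by exists a; split=> // k; apply/quotmod_proj_eq0.
Qed.

Lemma eq_flat_retract M N (i : {linear M -> N}) (r : {linear N -> M}) :
  (forall x, r (i x) = x) -> eq_flat N -> eq_flat M.
Proof.
move=> iK flN m l S e Se0.
have [j|n [X [y [yE SX]]]] := flN _ _ S (fun k => i (e k)).
  by rewrite -linear_comb Se0 linear0.
exists n, X, (fun t => r (y t)); split=> // k.
by rewrite -linear_comb -yE iK.
Qed.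

End Basics.

(** * Tensor products and flatness *)

Section CatFun.
Variables (T : Type) (m n : nat) (f : 'I_m -> T) (g : 'I_n -> T).

Definition cat_fun (k : 'I_(m + n)) : T :=
  match fintype.split k with inl i => f i | inr j => g j end.

Lemma cat_funl i : cat_fun (lshift n i) = f i.
Proof. by rewrite /cat_fun (unsplitK (inl _ i)). Qed.

Lemma cat_funr j : cat_fun (rshift m j) = g j.
Proof. by rewrite /cat_fun (unsplitK (inr _ j)). Qed.

End CatFun.

Section PureTensor.
Variables (R : pzRingType) (A : lmodType R^c) (E : lmodType R).
Implicit Types (a : A) (e : E) (r : R).

Lemma pure_tensorDl a a' e :
  pure_tensor (a + a') e = pure_tensor a e + pure_tensor a' e.
Proof. by have [+ _ _] := pure_tensor_balanced A E; apply. Qed.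

Lemma pure_tensorDr a e e' :
  pure_tensor a (e + e') = pure_tensor a e + pure_tensor a e'.
Proof. by have [_ + _] := pure_tensor_balanced A E; apply. Qed.

Lemma pure_tensorZ r a e :
  pure_tensor ((r : R^c) *: a) e = pure_tensor a (r *: e).
Proof. by have [_ _ +] := pure_tensor_balanced A E; apply. Qed.

Lemma pure_tensor0l e : pure_tensor (0 : A) e = 0.
Proof. by apply: (addrI (pure_tensor 0 e)); rewrite -pure_tensorDl !addr0. Qed.

Lemma pure_tensor0r a : pure_tensor a (0 : E) = 0.
Proof. by apply: (addrI (pure_tensor a 0)); rewrite -pure_tensorDr !addr0. Qed.

Lemma pure_tensor_suml (I : Type) (s : seq I) (F : I -> A) e :
  pure_tensor (\sum_(i <- s) F i) e = \sum_(i <- s) pure_tensor (F i) e.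
Proof.
elim: s => [|i s IHs]; first by rewrite !big_nil pure_tensor0l.
by rewrite !big_cons pure_tensorDl IHs.
Qed.

Lemma pure_tensor_sumr (I : Type) (s : seq I) (F : I -> E) a :
  pure_tensor a (\sum_(i <- s) F i) = \sum_(i <- s) pure_tensor a (F i).
Proof.
elim: s => [|i s IHs]; first by rewrite !big_nil pure_tensor0r.
by rewrite !big_cons pure_tensorDr IHs.
Qed.

(* An equality of tensors only uses finitely many linear relations [W] between
   elements of [E]: it persists under every map from [E] to [R] respecting
   them. *)
Lemma tensor_eq_relations (s t : seq (A * E)) : tensor_eq s t ->
  exists2 W : seq (seq (R * E)),
    forall w, w \in W -> \sum_(p <- w) p.1 *: p.2 = 0 &
    forall x : E -> R,
      (forall w, w \in W -> \sum_(p <- w) p.1 * x p.2 = 0) ->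
      \sum_(p <- s) (x p.2 : R^c) *: p.1 = \sum_(p <- t) (x p.2 : R^c) *: p.1.
Proof.
elim=> {s t} [s|s t _ [W W0 WE]|s t u _ [W W0 WE] _ [W' W'0 W'E]
  |s s' t t' _ [W W0 WE] _ [W' W'0 W'E]|s t|e|a a' e|a e e'|r a e].
- by exists [::].
- by exists W => // x /WE.
- exists (W ++ W') => [w|x xW]; first by rewrite mem_cat => /orP[/W0|/W'0].
  by rewrite WE ?W'E // => w wW; apply: xW; rewrite mem_cat wW ?orbT.
- exists (W ++ W') => [w|x xW]; first by rewrite mem_cat => /orP[/W0|/W'0].
  by rewrite !big_cat WE ?W'E // => w wW; apply: xW; rewrite mem_cat wW ?orbT.
- by exists [::] => // x _; rewrite !big_cat /= addrC.
- by exists [::] => // x _; rewrite big_seq1 big_nil scaler0.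
- by exists [::] => // x _; rewrite big_seq1 big_cons big_seq1 scalerDr.
(* Only additivity on the side of [E] and balancing constrain [x]: here by [(e + e') - e - e' = 0],
   next by the relation between [e] and the element [r *: e]. *)
- exists [:: [:: (1, e + e'); (-1, e); (-1, e')]] => [w|x xW].
    rewrite inE => /eqP ->; rewrite !big_cons big_nil /= !scaleN1r scale1r.
    by rewrite addr0 -opprD subrr.
  have := xW _ (mem_head _ _);
      rewrite !big_cons !big_nil /= !addr0 !mulN1r mul1r.
  by rewrite -opprD => /eqP; rewrite subr_eq0 => /eqP ->; rewrite scalerDl.
- exists [:: [:: (r, e); (-1, r *: e)]] => [w|x xW].
    by rewrite inE => /eqP ->;
      rewrite !big_cons big_nil /= scaleN1r addr0 subrr.
  have := xW _ (mem_head _ _); rewrite !big_cons !big_nil /= !addr0 !mulN1r.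
  by move=> /eqP; rewrite subr_eq0 => /eqP <-; rewrite scalerA.
Qed.

End PureTensor.

(** * Equational criterion for flatness and vanishing of tensors *)

Section FlatCriterion.
Variable R : pzRingType.

(** The relations [W] behind the vanishing of a tensor over [B] are a finite system solved in [E].
    Writing that solution through solutions over [R] gives maps [x t : E -> R] respecting [W]; they
    turn the tensor into equations in [B], which [i_inj] brings back to [A]. *)
Lemma eq_flat_flat (E : lmodType R) : eq_flat E -> flat E.
Proof.
move=> flE A B i i_inj.
suff h0 u : tensor_map i (idfun : {linear E -> E}) u = 0 -> u = 0.
  exact: raddf_inj.
rewrite -[u]reprK; move: (repr u) => s {u}.
rewrite tensor_mapE => /tensor_eqP/tensor_eq_relations[W W0 WE].
(* [U] lists once each element of [E] occurring in [s] or [W]. These are the unknowns, and [S]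
   collects their coefficients in each relation. *)
pose U := undup (map snd s ++ flatten (map (map snd) W)).
pose l := size U; pose e (k : 'I_l) := nth 0 U k.
pose w (j : 'I_(size W)) := nth [::] W j.
have wW j : w j \in W by exact: mem_nth.
pose S j k := \sum_(p <- w j | p.2 == e k) p.1.
have sumU (V : zmodType) (v : V) x : x \in U -> \sum_(k | e k == x) v = v.
  move=> xU; have ltx : (index x U < l)%N by rewrite index_mem.
  rewrite (big_pred1 (Ordinal ltx)) // => k.
  by rewrite /= -val_eqE /= -(nth_uniq 0 (ltn_ord k) ltx) ?undup_uniq
    ?nth_index.
have inUW j p : p \in w j -> p.2 \in U.
  move=> pw; rewrite mem_undup mem_cat; apply/orP; right.
  by apply/flattenP; exists (map snd (w j)); rewrite ?map_f.
have inUs p : p \in s -> p.2 \in U.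
  by move=> ps; rewrite mem_undup mem_cat map_f.
have [j|n [X [y [yE SX]]]] := flE _ _ S e.
  rewrite -[RHS](W0 _ (wW j)).
  under eq_bigr do rewrite scaler_suml big_mkcond.
  rewrite exchange_big big_seq [RHS]big_seq; apply: eq_bigr => p pw.
  rewrite -big_mkcond -[RHS](sumU _ _ _ (inUW _ _ pw)).
  rewrite (eq_bigl (fun k => e k == p.2)); last by move=> k; rewrite eq_sym.
  by apply: eq_bigr => k /eqP ->.
(* Column [t] of [X] as a function on [E], zero outside [U]. *)
pose x t (z : E) := \sum_(k | e k == z) X k t.
have xE z : z \in U -> z = \sum_t x t z *: y t.
  move=> zU; under eq_bigr do rewrite scaler_suml.
  rewrite exchange_big -[LHS](sumU _ _ _ zU); apply: eq_bigr => k /eqP <-.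
  exact: yE.
have xW t v : v \in W -> \sum_(p <- v) p.1 * x t p.2 = 0.
  move=> /(nthP [::])[j ltj vE]; rewrite -{v}vE -[RHS](SX (Ordinal ltj) t).
  under [RHS]eq_bigr do rewrite mulr_suml big_mkcond.
  rewrite exchange_big; apply: eq_bigr => p _.
  rewrite -[RHS]big_mkcond mulr_sumr.
  by apply: eq_bigl => k; rewrite eq_sym.
have xs0 t : \sum_(p <- s) (x t p.2 : R^c) *: p.1 = 0.
  apply: i_inj; rewrite linear0 linear_sum; have := WE _ (xW t).
  rewrite big_map big_nil /= => {2}<-.
  by apply: eq_bigr => p _; rewrite linearZ.
rewrite tensor_sumE big_seq.
rewrite (eq_bigr (fun p => \sum_t pure_tensor ((x t p.2 : R^c) *: p.1) (y t))).
  rewrite -big_seq exchange_big big1 // => t _.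
  by rewrite -pure_tensor_suml xs0 pure_tensor0l.
move=> p ps; rewrite [in LHS](xE _ (inUs _ ps)) pure_tensor_sumr.
by apply: eq_bigr => t _; rewrite pure_tensorZ.
Qed.

(* The tensor product of [E] with the cokernel of [H -> R^l] is the quotient of
   [E^l] by [H E]. *)
Lemma tensor_generators_eq0 (A : lmodType R^c) (E : lmodType R) l
    (alpha : 'I_l -> A) (e : 'I_l -> E) :
  (forall a, exists c : 'I_l -> R, a = \sum_k (c k : R^c) *: alpha k) ->
  \sum_k pure_tensor (alpha k) (e k) = 0 ->
  exists n (c : 'I_l -> 'I_n -> R) (y : 'I_n -> E),
    (forall k, e k = \sum_t c k t *: y t) /\
    (forall t, \sum_k (c k t : R^c) *: alpha k = 0).
Proof.
move=> /choice[sg sgK].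
(* [HE] is the subgroup of [E^l] generated by the products of a relation between the [alpha k] with
   an element of [E]. *)
pose HE : {pred 'I_l -> E} := fun v => `[< exists n (c : 'I_l -> 'I_n -> R)
    (y : 'I_n -> E), (forall k, v k = \sum_t c k t *: y t) /\
    (forall t, \sum_k (c k t : R^c) *: alpha k = 0) >].
have HE_closed : zmod_closed HE.
  split=> [|u v /asboolP[n [c [y [uE c0]]]] /asboolP[n' [c' [y' [vE c'0]]]]].
    apply/asboolP; exists 0, (fun _ _ => 0), (fun _ => 0).
    by split=> [k|[]//]; rewrite big_ord0.
  apply/asboolP; exists (n + n')%N, (fun k => cat_fun (c k) (c' k)),
    (cat_fun y (fun t => - y' t)); split=> [k|t].
    rewrite big_split_ord /= -[LHS]/(u k - v k) uE vE -sumrN.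
    congr (_ + _); apply: eq_bigr => t _; rewrite ?cat_funl ?cat_funr //.
    by rewrite scalerN.
  rewrite -[t]splitK; case: (fintype.split t) => {}t /=.
    by under eq_bigr do rewrite cat_funl.
  by under eq_bigr do rewrite cat_funr.
pose HEz : zmodClosed _ :=
  HB.pack HE (GRing.isZmodClosed.Build _ HE HE_closed).
pose Q : zmodType := Quotient.quot HEz.
pose pr (v : 'I_l -> E) : Q := \pi v.
have prD u v : pr (u + v) = pr u + pr v by exact: Quotient.pi_add.
have prP u v : u - v \in HE -> pr u = pr v.
  by rewrite -[u - v \in HE]/(u - v \in HEz) Quotient.idealrBE => /eqP.
have prP' (u v : 'I_l -> R) (x : E) :
    \sum_k (u k : R^c) *: alpha k = \sum_k (v k : R^c) *: alpha k ->
    pr (fun k => u k *: x) = pr (fun k => v k *: x).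
  move=> uv; apply: prP; apply/asboolP.
  exists 1, (fun k _ => u k - v k), (fun _ => x); split=> [k|t].
    by rewrite big_ord1 scalerBl.
  by under eq_bigr do rewrite scalerBl; rewrite sumrB uv subrr.
(* Modulo [HE], the choice [sg] of coordinates does not matter, by [prP']; this is what makes [b]
   balanced. *)
pose b (a : A) (x : E) : Q := pr (fun k => sg a k *: x).
have b_bal : balanced b.
  split=> [a a' x|a x x'|r a x]; rewrite /b -?prD.
  - rewrite (prP' _ (fun k => sg a k + sg a' k)).
      by congr pr; apply/funext => k; rewrite scalerDl.
    by rewrite -sgK; under eq_bigr do rewrite scalerDl;
      rewrite big_split /= -!sgK.
  - by congr pr; apply/funext => k; rewrite scalerDr.
  - rewrite (prP' _ (fun k => sg a k * r)).
      by congr pr; apply/funext => k; rewrite scalerA.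
    rewrite -sgK {1}(sgK a) scaler_sumr; apply: eq_bigr => k _.
    by rewrite scalerA.
have [f fE _] := tensor_universal b_bal.
move=> /(congr1 f); rewrite raddf0 raddf_sum.
under eq_bigr do rewrite fE.
have -> : \sum_k b (alpha k) (e k) = pr e.
  have pr_sum (s : seq 'I_l) (F : 'I_l -> 'I_l -> E) :
      \sum_(k <- s) pr (F k) = pr (fun j => \sum_(k <- s) F k j).
    elim: s => [|k s IHs].
      rewrite big_nil; apply: (addrI (pr 0)); rewrite addr0 -prD add0r.
      by congr pr; apply/funext => j; rewrite big_nil.
    rewrite big_cons IHs -prD; congr pr; apply/funext => j.
    by rewrite big_cons.
  (* For the same reason the coordinates [sg (alpha k)] may be replaced by the [k]-th unit
     vector. *)
  rewrite (eq_bigr (fun k => pr (fun j => ((j == k)%:R : R) *: e k))).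
    by rewrite pr_sum; congr pr; apply/funext => j; rewrite sum_deltaZ.
  move=> k _; apply: prP'; rewrite -sgK -[LHS](@sum_deltaZ R^c).
  by apply: eq_bigr => j _; rewrite eq_sym.
have -> : 0 = pr 0 by apply: (addrI (pr 0)); rewrite -prD !addr0.
move=> /eqP; rewrite -[_ == _]Quotient.idealrBE subr0 => /asboolP.
by [].
Qed.

End FlatCriterion.

(** * From flatness and purity to equations *)

Section TensorToEquations.
Variable R : pzRingType.

Section Columns.
Variables (m l : nat) (S : 'I_m -> 'I_l -> R).

Let V : lmodType R^c := 'I_m -> (R^c)^o.

Definition coord_col (j : 'I_m) : V := fun j' => (j' == j)%:R.

Definition column (k : 'I_l) : V := fun j => S j k.

Lemma col_decomp (v : V) : v = \sum_j (v j : R^c) *: coord_col j.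
Proof.
apply/funext => j; rewrite fct_sumE (bigD1 j) //= big1.
  by rewrite addr0 scalrfctE /coord_col eqxx -[RHS]/(_ * _) mulr1.
move=> j' /negPf j'j; rewrite scalrfctE /coord_col eq_sym j'j.
by rewrite -[LHS]/(_ * _) mulr0.
Qed.

Lemma span_columns_submod :
  is_submod (fun v : V => exists c : 'I_l ->
    R, v = \sum_k (c k : R^c) *: column k).
Proof.
split=> [|r _ _ [c ->] [d ->]].
  by exists (fun _ => 0); rewrite big1 // => k _; rewrite scale0r.
exists (fun k => (r : R^c) * c k + d k); rewrite scaler_sumr -big_split /=.
by apply: eq_bigr => k _; rewrite scalerDl scalerA.
Qed.

Definition column_span : submodClosed V := submod_of span_columns_submod.

Lemma column_in_span k : column k \in column_span.
Proof.
apply/submod_ofP; exists (fun k' => (k == k')%:R).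
by rewrite (@sum_deltaZ R^c).
Qed.

End Columns.

(** Flatness is applied to the inclusion of the column span of [S] in [R^m]. The sum of the tensors
    of column [k] with [e k] vanishes in the larger tensor product by [Se0], hence in the smaller
    one, where [tensor_generators_eq0] reads off [X] and [y]. *)
Lemma flat_eq_flat (E : lmodType R) : flat E -> eq_flat E.
Proof.
move=> flE m l S e Se0.
pose alpha k : submod (column_span S) := Submod (column_in_span S k).
have gen (a : submod (column_span S)) :
    exists c : 'I_l -> R, a = \sum_k (c k : R^c) *: alpha k.
  case: a => v vS; have /submod_ofP[c vE] := vS; exists c.
  apply: (@submod_incl_inj R^c); rewrite linear_sum -[LHS]/v vE.
  by apply: eq_bigr => k _; rewrite linearZ.
have t0 : \sum_k pure_tensor (alpha k) (e k) = 0.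
  apply: (flE _ _ _ (@submod_incl_inj R^c _ (column_span S))).
  rewrite raddf0 raddf_sum.
  rewrite (eq_bigr (fun k => \sum_j pure_tensor (coord_col j) (S j k *: e k))).
    rewrite exchange_big big1 // => j _.
    by rewrite -pure_tensor_sumr Se0 pure_tensor0r.
  move=> k _; rewrite [LHS]tensor_map_pure [submod_incl _ _]col_decomp.
  by rewrite pure_tensor_suml; apply: eq_bigr => j _; rewrite pure_tensorZ.
have [n [c [y [eE c0]]]] := tensor_generators_eq0 gen t0.
exists n, c, y; split=> // j t.
have /(congr1 (fun a => submod_incl _ a j)) := c0 t.
by rewrite linear_sum linear0 fct_sumE.
Qed.

(** Purity is tested on the cokernel of [S], generated by the classes [alpha j]. The sum of the
    tensors of [alpha j] with [a j] dies over [B], so over [A], and the relations between the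
    [alpha j] are the combinations of columns of [S]. *)
Lemma pure_equations (A B : lmodType R) (i : {linear A -> B}) : pure i ->
  forall m l (S : 'I_m -> 'I_l -> R) (a : 'I_m -> A) (b : 'I_l -> B),
    (forall j, i (a j) = \sum_k S j k *: b k) ->
  exists a' : 'I_l -> A, forall j, a j = \sum_k S j k *: a' k.
Proof.
move=> pui m l S a b ab; pose N := column_span S.
pose alpha j := quotmod_proj N (coord_col j).
have alphaE v : quotmod_proj N v = \sum_j (v j : R^c) *: alpha j.
  by rewrite {1}[v]col_decomp linear_comb.
have gen (x : quotmod N) : exists c : 'I_m ->
    R, x = \sum_j (c j : R^c) *: alpha j.
  by have [v <-] := quotmod_proj_surj x; exists v; exact: alphaE.
have t0 : \sum_j pure_tensor (alpha j) (a j) = 0.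
  apply: (pui (quotmod N)); rewrite raddf0 raddf_sum.
  rewrite (eq_bigr (fun j =>
    \sum_k pure_tensor ((S j k : R^c) *: alpha j) (b k))).
    rewrite exchange_big big1 // => k _.
    rewrite -pure_tensor_suml -(alphaE (column S k)).
    by rewrite (proj2 (quotmod_proj_eq0 _ _) (column_in_span S k))
      pure_tensor0l.
  move=> j _; rewrite [LHS]tensor_map_pure ab pure_tensor_sumr.
  by apply: eq_bigr => k _; rewrite pure_tensorZ.
have [n [c [y [aE c0]]]] := tensor_generators_eq0 gen t0.
have /choice[d dE] t : exists d : 'I_l ->
    R, (fun j => c j t) = \sum_k (d k : R^c) *: column S k.
  by apply/(submod_ofP (span_columns_submod S))/quotmod_proj_eq0;
    rewrite alphaE.
exists (fun k => \sum_t d t k *: y t) => j; rewrite aE.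
under [RHS]eq_bigr do rewrite scaler_sumr.
rewrite exchange_big; apply: eq_bigr => t _.
have /(congr1 (fun v => v j)) := dE t; rewrite fct_sumE => ->.
by rewrite scaler_suml; apply: eq_bigr => k _; rewrite scalerA.
Qed.

(** Lift the images of the generators to [b] in [B]. The relations of [P] then take values in [A],
    and purity solves the same system by [a'] in [A]; the corrected lifts [b - i a'] satisfy the
    relations. *)
Lemma finitely_presented_pure_projective (P : lmodType R) :
  finitely_presented P -> pure_projective P.
Proof.
move=> [m [l [d [p [dp p_surj]]]]] A B C i q [i_inj iq q_surj] pui f.
have [s sK] := choice q_surj.
pose b k := s (f (p (delta_mx 0 k))).
have qb v : q (rowlin b v) = f (p v).
  rewrite rowlinE linear_comb (linear_rowE p) linear_comb.
  by apply: eq_bigr => k _; rewrite sK.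
pose S j k := d (delta_mx 0 j) 0 k.
have /choice[a aE] j : exists a, i a = \sum_k S j k *: b k.
  apply/iq; rewrite -rowlinE qb; apply/eqP; rewrite -(linear0 f); apply/eqP.
  by congr (f _); apply/dp; exists (delta_mx 0 j).
have [a' a'E] := pure_equations pui aE.
pose h' := rowlin (fun k => b k - i (a' k)).
have [x px0|h hE] := linear_factor (q := h') p_surj.
  have /dp[w <-] := px0; rewrite (linear_rowE d) linear_comb big1 // => j _.
  rewrite rowlinE; under eq_bigr do rewrite scalerBr.
  by rewrite sumrB -aE a'E linear_comb subrr scaler0.
exists h => x; have [v <-] := p_surj x.
rewrite /= hE rowlinE linear_comb (linear_rowE p) linear_comb.
apply: eq_bigr => k _; rewrite linearB sK (proj2 (iq (i (a' k)))) ?subr0 //.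
by exists (a' k).
Qed.

End TensorToEquations.

(** * Zorn's lemma and the injectivity of Q/Z *)

Lemma Zorn_above (T : Type) (P : set (set T)) (A0 : set T) : P A0 ->
  (forall F : set (set T), F !=set0 -> total_on F subset ->
    (forall A, F A -> A0 `<=` A /\ P A) -> P (\bigcup_(X in F) X)) ->
  exists A, [/\ A0 `<=` A, P A & forall B, A `<=` B -> P B -> B `<=` A].
Proof.
move=> PA0 Pcup.
pose P' (A : set T) := A = set0 \/ (A0 `<=` A /\ P A).
have [|A [P'A Amax]] := @Zorn_bigcup T P'.
  move=> F FP' Ftot.
  have [[B FB [x Bx]]|noB] := pselect (exists2 B, F B & B !=set0); last first.
    left; rewrite -subset0 => x [B FB Bx]; case: noB; exists B => //.
    by exists x.
  pose F' := F `&` [set X | X !=set0].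
  have -> : \bigcup_(X in F) X = \bigcup_(X in F') X.
    apply/seteqP; split=> y [C FC Cy]; exists C => //; last by case: FC.
    by split=> //; exists y.
  have F'P C : F' C -> A0 `<=` C /\ P C.
    by move=> [/FP'[->[y []]|//]].
  have F'B : F' B by split=> //; exists x.
  right; split; first by move=> y A0y; exists B => //; exact: (F'P _ F'B).1.
  by apply: Pcup => //; [exists B|move=> s t [Fs _] [Ft _]; exact: Ftot].
have A0A : A0 `<=` A.
  case: P'A => [AE|[]//] x A0x; exfalso; apply: (Amax A0); last by right; split.
  by rewrite AE; split=> [y []|/(_ _ A0x)].
exists A; split=> // [|B AB PB].
  case: P'A => [AE|[]//]; suff -> : A = A0 by [].
  by apply/seteqP; split=> //; rewrite AE => y [].
apply: contrapT => BA; apply: (Amax B); first by split.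
by right; split=> //; exact: subset_trans AB.
Qed.

Section RationalsModIntegers.

(** The generator is the least positive element, by division with remainder, or 0 if there is
    none. *)
Lemma int_subgroup_cyclic (I : int -> Prop) :
  I 0 -> (forall m n, I m -> I n -> I (m - n)) ->
  exists2 d : nat, I d%:Z & forall n, I n -> exists k : int, n = k * d%:Z.
Proof.
move=> I0 IB.
have IN n : I n -> I (- n) by rewrite -[- n]add0r; exact: IB.
have ID m n : I m -> I n -> I (m + n) by rewrite -{2}[n]opprK => Im /IN;
    exact: IB.
have IM k n : I n -> I (k * n).
  move=> In; elim: k => [|k IHk|k IHk]; first by rewrite mul0r.
    by rewrite intS mulrDl mul1r; exact: ID.
  by rewrite intS opprD mulrDl mulN1r; apply: ID => //; exact: IN.
have [[d d_gt0 Id]|nod] := pselect (exists2 d : nat, (0 < d)%N & I d%:Z);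
    last first.
  exists 0%N => // n In; exists 0; rewrite mul0r; apply/eqP.
  apply: contrapT => n0; apply: nod; exists `|n|%N.
    by rewrite absz_gt0; exact/negP.
  by case: n In {n0} => k //; exact: IN.
pose Q d := (0 < d)%N && `[< I d%:Z >].
have exQ : exists d, Q d by exists d; rewrite /Q d_gt0; exact/asboolP.
case: (ex_minnP exQ) => {d_gt0 Id} c /andP[c_gt0 /asboolP Ic] c_min.
exists c => // n In; exists (n %/ c%:Z)%Z.
have c0 : c%:Z != 0 by rewrite eqz_nat -lt0n.
have Ir : I (n %% c%:Z)%Z.
  have -> : (n %% c%:Z)%Z = n - (n %/ c%:Z)%Z * c%:Z.
    by rewrite {2}(divz_eq n c%:Z) addrC addKr.
  by apply: IB => //; exact: IM.
have := modz_ge0 n c0; have : ((n %% c%:Z)%Z < c%:Z) by rewrite ltz_pmod.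
rewrite [X in X = _](divz_eq n c%:Z).
case: (n %% c%:Z)%Z Ir => [r|//] Ir; rewrite ltz_nat => rc _.
suff -> : r = 0%N by rewrite addr0.
apply/eqP; rewrite -leqn0 leqNgt; apply/negP => r_gt0.
by have := c_min r; rewrite /Q r_gt0 leqNgt rc => /(_ (introT (asboolP _) Ir)).
Qed.

Lemma QmodZ_divisible (q : QmodZ) d : (0 < d)%N ->
    exists q' : QmodZ, q' *+ d = q.
Proof.
move=> d_gt0; exists (\pi_QmodZ (repr q / d%:R)).
rewrite -raddfMn -(mulr_natr (repr q / _)) mulfVK //.
  exact: reprK.
by rewrite pnatr_eq0 -lt0n.
Qed.

Lemma QmodZ_torsion d : (1 < d)%N -> exists2 q : QmodZ, q != 0 & q *+ d = 0.
Proof.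
move=> d_gt1; have d0 : d%:R != 0 :> rat by rewrite pnatr_eq0; case: d d_gt1.
have piE (x : rat) : (\pi_QmodZ x == 0) = (x \is a Num.int).
  by rewrite -[RHS]/(x \in rat_int) -[x in RHS]subr0 Quotient.idealrBE
    -(raddf0 \pi_QmodZ).
exists (\pi_QmodZ d%:R^-1).
  rewrite piE; apply/negP => /intrP[k kE].
  have : (k * d%:Z)%:~R = 1%:~R :> rat by rewrite intrM -kE /= mulVf.
  move/eqP; rewrite eqr_int => /eqP/(congr1 absz); rewrite abszM /=.
  by move/eqP; rewrite muln_eq1 => /andP[_ /eqP d1]; rewrite d1 in d_gt1.
by apply/eqP; rewrite -raddfMn piE -(mulr_natr d%:R^-1) mulVf.
Qed.

(** These are the graphs of additive maps from subgroups of [B] to [QmodZ]: for a subgroup, being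
    single-valued at 0 suffices. *)
Definition additive_graph (B : zmodType) (G : set (B * QmodZ)) : Prop :=
  [/\ G (0, 0), forall p q, G p -> G q -> G (p - q) & forall z, G (0, z) ->
    z = 0].

(** A maximal graph is total: the [n] with [b *~ n] in its domain are the multiples of some [d], and
    dividing the value at [b *~ d] by [d] gives an admissible value at [b]. *)
Lemma additive_graph_extend (B : zmodType) (G0 : set (B * QmodZ)) :
  additive_graph G0 ->
  exists f : {additive B -> QmodZ}, forall b z, G0 (b, z) -> f b = z.
Proof.
move=> G0g; have [|G [G0G [G00 GB Gz] Gmax]] := @Zorn_above _ _ G0 G0g.
  move=> F [A FA] Ftot Fg; split=> [|p q [X FX Xp] [Y FY Yq]|z [X FX Xz]].
  - by exists A => //; case: (Fg _ FA) => _ [].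
  - have [XY|YX] := Ftot _ _ FX FY.
      by exists Y => //; case: (Fg _ FY) => _ [_ + _]; apply => //; exact: XY.
    by exists X => //; case: (Fg _ FX) => _ [_ + _]; apply => //; exact: YX.
  - by case: (Fg _ FX) => _ [_ _]; apply.
have Gex b : exists z, G (b, z).
  pose I n := exists z, G (b *~ n, z).
  have [|m n [z Gm] [z' Gn]|d [z0 Gd] dI] := @int_subgroup_cyclic I.
  - by exists 0.
  - by exists (z - z'); rewrite mulrzBr; exact: (GB _ _ Gm Gn).
  have GN p : G p -> G (- p) by rewrite -[- p]add0r; exact: GB.
  have GD p q : G p -> G q -> G (p + q).
    by rewrite -{2}[q]opprK => Gp /GN; exact: GB.
  have GM (k : int) p : G p -> G (p *~ k).
    move=> Gp; elim: k => [|k IHk|k IHk]; first by rewrite mulr0z.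
      by rewrite intS mulrzDr mulr1z; exact: GD.
    by rewrite intS opprD mulrzDr mulrN1z; apply: GD => //; exact: GN.
  have [q qE] : exists q : QmodZ, q *+ d = z0.
    (* If [d = 0], no nonzero multiple of [b] is in the domain and any [q] would do. *)
    case: d Gd {dI} => [|d] Gd; last exact: QmodZ_divisible.
    by exists 0; rewrite (Gz z0).
  have Gq n z : G (b *~ n, z) -> z = q *~ n.
    move=> Gn; have [|k nE] := dI n; first by exists z.
    apply/eqP; rewrite -subr_eq0; apply/eqP/Gz.
    have := GB _ _ Gn (GM k _ Gd).
    have -> : (b *~ d, z0) *~ k = (b *~ d *~ k, z0 *~ k).
      have pM (n' : nat) : (b *~ d, z0) *+ n' = (b *~ d *+ n', z0 *+ n').
        by elim: n' => // n' IH; rewrite !mulrS IH.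
      by case: k {nE} => k; rewrite ?NegzE ?mulrNz -!pmulrn pM.
    by rewrite nE mulrC !mulrzA -qE -[(_, _) - _]/(_ - _, _ - _) subrr.
  exists q.
  (* The subgroup generated by [G] and [(b, q)]; it is single-valued by [Gq]. *)
  have GH := Gmax (fun p => exists n : int, G (p - (b *~ n, q *~ n))).
  apply: GH; last 1 first.
  - by exists 1; rewrite !mulr1z subrr.
  - by move=> p Gp; exists 0; rewrite !mulr0z subr0.
  split=> [|p p' [n Gn] [n' Gn']|z [n Gn]].
  - by exists 0; rewrite !mulr0z subr0.
  - exists (n - n'); have := GB _ _ Gn Gn'.
    have -> : (b *~ (n - n'), q *~ (n - n')) = (b *~ n, q *~ n) - (b *~ n',
        q *~ n').
      by rewrite !mulrzBr.
    by rewrite !opprD !opprK addrACA.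
  - have /Gq : G (b *~ (- n), z - q *~ n) by rewrite mulrNz -[- _]add0r.
    by rewrite mulrNz -[X in _ = X -> _]add0r => /addIr.
have [f fG] := choice Gex.
have Gfun b z z' : G (b, z) -> G (b, z') -> z = z'.
  move=> Gz1 Gz2; apply/eqP; rewrite -subr_eq0; apply/eqP/Gz.
  by have := GB _ _ Gz1 Gz2; rewrite -[(_, _) - _]/(_ - _, _ - _) subrr.
have f_add : zmod_morphism f.
  by move=> x y; apply: (Gfun (x - y)) => //; exact: (GB _ _ (fG x) (fG y)).
exists (additive_of f_add).
by move=> b z /G0G; exact: Gfun.
Qed.

Lemma QmodZ_injective (A B : zmodType) (i : {additive A -> B}) :
  injective i -> forall f : {additive A -> QmodZ},
  exists h : {additive B -> QmodZ}, forall x, h (i x) = f x.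
Proof.
move=> i_inj f.
have [|h hE] := @additive_graph_extend B (fun p => exists x, p = (i x, f x)).
  split=> [|_ _ [x ->] [y ->]|z [x [ix0 ->]]].
  - by exists 0; rewrite !raddf0.
  - by exists (x - y); rewrite !raddfB.
  - have -> : x = 0 by apply: i_inj; rewrite raddf0.
    exact: raddf0.
by exists h => x; apply: hE; exists x.
Qed.

Lemma QmodZ_separates (M : zmodType) (x : M) : x != 0 ->
  exists f : {additive M -> QmodZ}, f x != 0.
Proof.
move=> x0; have [|m n xm xn|d xd dI] :=
  @int_subgroup_cyclic (fun n => x *~ n = 0).
- exact: mulr0z.
- by rewrite mulrzBr xm xn subrr.
(* [c] is the order of [x], or 2 if that order is infinite, so that [x] may be sent to any [q] with
   [q *+ c = 0]. *)
have [c c_gt1 cI] : exists2 c : nat, (1 < c)%N &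
    forall n, x *~ n = 0 -> exists k : int, n = k * c%:Z.
  case: d xd dI => [|[|d]] xd dI; last by exists d.+2.
    exists 2%N => // n /dI[k ->]; exists 0; by rewrite mulr0 mul0r.
  by case/eqP: x0; rewrite -[x]mulr1z.
have [q q0 qc] := QmodZ_torsion c_gt1.
have [|h hE] := @additive_graph_extend M
    (fun p => exists n : int, p = (x *~ n, q *~ n)).
  split=> [|_ _ [m ->] [n ->]|z [n [xn ->]]].
  - by exists 0; rewrite !mulr0z.
  - by exists (m - n); rewrite !mulrzBr.
  - have [k ->] := cI n (esym xn); rewrite mulrC mulrzA -pmulrn qc.
    exact: mul0rz.
by exists h; rewrite (hE x q) //; exists 1; rewrite !mulr1z.
Qed.

End RationalsModIntegers.

(** * Character modules and injective cogenerators *)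

Section CharacterModules.
Variable R : pzRingType.

Lemma char_valD (F : lmodType R^c) (phi : char_module F) x y :
  phi (x + y) = phi x + phi y.
Proof. by case: phi => f /= /asboolP; apply. Qed.

Lemma char_of_additive (F : lmodType R^c) (f : {additive F -> QmodZ}) :
  (f : F -> QmodZ) \in @char_pred R F.
Proof. by apply/asboolP => x y; exact: raddfD. Qed.

(** By the tensor-hom adjunction, maps from [A] to the character module are characters of the tensor
    product of [F] and [A]. These extend, since [F] preserves injectivity of [i] and [QmodZ] is
    injective. *)
Lemma flat_right_char_injective (F : lmodType R^c) :
  flat_right F -> injective_module (char_module F).
Proof.
move=> flF A B i i_inj f.
have f_bal : balanced (fun x a => f a x).
  split=> [x y a|x a a'|r x a]; first exact: char_valD.
  - by rewrite linearD.
  - by rewrite linearZ.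
have [phi phiE _] := tensor_universal f_bal.
have [psi psiE] := QmodZ_injective (flF _ _ _ i_inj) phi.
have h_proof b : (fun x => psi (pure_tensor x b)) \in @char_pred R F.
  by apply/asboolP => x y; rewrite pure_tensorDl raddfD.
have h_lin : linear (fun b => CharModule (h_proof b)).
  move=> r b b'; apply: char_moduleP => x /=.
  by rewrite pure_tensorDr raddfD -pure_tensorZ.
exists (linear_of h_lin) => a; apply: char_moduleP => x /=.
by rewrite -phiE -psiE /= tensor_map_pure.
Qed.

(** Linear maps from [M] to this module correspond, by evaluation at 1, to additive maps from [M] to
    [QmodZ]; [to_reg_char] is the inverse correspondence. *)
Definition reg_char : lmodType R := char_module (R^c)^o.

Section RegChar.
Variables (M : lmodType R) (f : {additive M -> QmodZ}).

Lemma reg_char_proof (x : M) :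
  (fun r : (R^c)^o => f ((r : R) *: x)) \in @char_pred R (R^c)^o.
Proof. by apply/asboolP => r s; rewrite scalerDl raddfD. Qed.

Definition to_reg_char (x : M) : reg_char := CharModule (reg_char_proof x).

Lemma to_reg_char_linear : linear to_reg_char.
Proof.
move=> r x y; apply: char_moduleP => s /=.
by rewrite scalerDr raddfD scalerA.
Qed.

End RegChar.

Lemma reg_char_power_injective (J : Type) : injective_module (J -> reg_char).
Proof.
move=> A B i i_inj f.
have phi_add j : zmod_morphism (fun a => f a j 1).
  by move=> a a'; rewrite linearB.
have /choice[psi psiE] j := QmodZ_injective i_inj (additive_of (phi_add j)).
have h_lin : linear (fun b j => to_reg_char (psi j) b).
  by move=> r b b'; apply/funext => j; exact: to_reg_char_linear.
exists (linear_of h_lin) => a; apply/funext => j; apply: char_moduleP => r /=.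
rewrite -linearZ psiE /= linearZ.
by rewrite -[LHS]/(f a j ((r : R^c) * 1)) mulr1.
Qed.

(** Indexing by all functions [T -> QmodZ], additive or not, makes the module depend on [T] only:
    one injective module receives every module that is an image of [T]. *)
Definition cogenerator (T : Type) : lmodType R := (T -> QmodZ) -> reg_char.

Lemma cogenerator_injective T : injective_module (cogenerator T).
Proof. exact: reg_char_power_injective. Qed.

Lemma embed_cogenerator (T : Type) (M : lmodType R) (e : T -> M) :
  surjective_map e -> exists i : {linear M -> cogenerator T}, injective i.
Proof.
move=> e_surj.
(* [ext psi] is the character of [M] that [psi] describes through [e], if there is one, and is
   unspecified otherwise. *)
have /choice[ext extE] (psi : T -> QmodZ) : exists phi : {additive M -> QmodZ},
    (exists phi' : {additive M -> QmodZ}, phi' \o e =1 psi) -> phi \o e =1 psi.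
  have [[phi phiE]|no] := pselect (exists phi : {additive M ->
      QmodZ}, phi \o e =1 psi).
    by exists phi.
  by exists (\0 : {additive M -> QmodZ}).
have i_lin : linear (fun x psi => to_reg_char (ext psi) x).
  by move=> r x y; apply/funext => psi; exact: to_reg_char_linear.
exists (linear_of i_lin).
suff i0 x : linear_of i_lin x = 0 -> x = 0.
  exact: raddf_inj.
apply: contraPP => /eqP/QmodZ_separates[phi phix] ix0; case/eqP: phix.
have : ext (phi \o e) (1 *: x) = 0.
  exact: (congr1 (fun v : cogenerator T => v (phi \o e) 1) ix0).
rewrite scale1r => <-; have [t <-] := e_surj x.
by rewrite -[RHS]/((ext (phi \o e) \o e) t) extE //; exists phi.
Qed.

Lemma embeds_in_injective (M : lmodType R) : exists (E : lmodType R)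
  (i : {linear M -> E}), injective_module E /\ injective i.
Proof.
have [|i i_inj] := @embed_cogenerator M M id; first by move=> x; exists x.
by exists (cogenerator M), i; split=> //; exact: cogenerator_injective.
Qed.

End CharacterModules.

(** * Direct sums *)

Lemma eq_big_uniq_support (I : eqType) (N : zmodType) (F : I ->
    N) (s t : seq I) :
  uniq s -> uniq t -> (forall i, i \notin s -> F i = 0) ->
  (forall i, i \notin t -> F i = 0) -> \sum_(i <- s) F i = \sum_(i <- t) F i.
Proof.
move=> us ut Fs Ft.
have nz r : \sum_(i <- r) F i = \sum_(i <- [seq i <- r | F i != 0]) F i.
  by rewrite big_filter [RHS]big_mkcond; apply: eq_bigr => i _; case: eqP.
rewrite nz [RHS]nz; apply: perm_big; apply: uniq_perm; rewrite ?filter_uniq //.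
move=> i; rewrite !mem_filter; case: eqP => //= /eqP Fi.
by apply/idP/idP => _; apply: contraNT Fi => ?; apply/eqP;
  [exact: Ft|exact: Fs].
Qed.

Section DirectSum.
Variables (R : pzRingType) (V : lmodType R) (I : choiceType).
Variable K : I -> submodClosed V.

Lemma dsum_submod : is_submod (fun x : I -> V =>
  (forall i, x i \in K i) /\ exists s : seq I, forall i, i \notin s -> x i = 0).
Proof.
split=> [|r x y [xK [s xs]] [yK [t yt]]].
  by split=> [i|]; [exact: rpred0 | exists [::]].
split=> [i|]; first by rewrite -[_ i]/(r *: x i + y i) rpredD ?rpredZ.
exists (s ++ t) => i; rewrite mem_cat negb_or => /andP[/xs xi /yt yi].
by rewrite -[LHS]/(r *: x i + y i) xi yi scaler0 addr0.
Qed.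

(** The summands are submodules of one module [V], so the direct sum lives in the plain function
    module [I -> V] and needs no dependent families. *)
Definition dsum : lmodType R := submod (submod_of dsum_submod).

Lemma dsum_proj_proof (x : dsum) i : submod_val x i \in K i.
Proof. by case: x => x xK; have /submod_ofP[+ _] := xK; apply. Qed.

Definition dsum_proj i : {linear dsum -> submod (K i)}.
Proof.
by apply: (@linear_of _ _ _ (fun x => Submod (dsum_proj_proof x i))) => r x y;
  apply: val_inj.
Defined.

Lemma dsum_incl_proof i (v : submod (K i)) :
  (fun j => if j == i then submod_val v else 0) \in submod_of dsum_submod.
Proof.
apply/submod_ofP; split=> [j|].
  by case: eqP => [->|_]; [case: v | exact: rpred0].
by exists [:: i] => j; rewrite inE => /negPf ->.
Qed.

Definition dsum_incl i : {linear submod (K i) -> dsum}.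
Proof.
apply: (@linear_of _ _ _ (fun v => Submod (dsum_incl_proof v))) => r v w.
apply: val_inj; apply/funext => j /=.
rewrite -[RHS]/(r *: (if _ then _ else _) + (if _ then _ else _)).
by case: eqP => _ //; rewrite scaler0 addr0.
Defined.

Lemma dsum_inclE i v j :
  submod_val (dsum_incl i v) j = if j == i then submod_val v else 0.
Proof. by []. Qed.

Lemma dsum_inclK i v : dsum_proj i (dsum_incl i v) = v.
Proof. by apply: val_inj; rewrite /= eqxx. Qed.

Lemma dsum_proj_incl i j v : i != j -> dsum_proj i (dsum_incl j v) = 0.
Proof. by move=> /negPf ij; apply: val_inj; rewrite /= ij. Qed.

Lemma dsum_support (x : dsum) :
  exists2 s : seq I, uniq s & forall i, i \notin s -> dsum_proj i x = 0.
Proof.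
case: x => x xK; have /submod_ofP[_ [s xs]] := xK.
exists (undup s); first exact: undup_uniq.
by move=> i; rewrite mem_undup => /xs xi; apply: val_inj.
Qed.

Lemma submod_val_sum (J : Type) (s : seq J) (F : J -> dsum) i :
  submod_val (\sum_(j <- s) F j) i = \sum_(j <- s) submod_val (F j) i.
Proof.
by rewrite -[submod_val _]/(submod_incl _ _) linear_sum fct_sumE.
Qed.

Lemma dsum_decomp (x : dsum) (s : seq I) :
  uniq s -> (forall i, i \notin s -> dsum_proj i x = 0) ->
  x = \sum_(i <- s) dsum_incl i (dsum_proj i x).
Proof.
move=> us xs; apply: val_inj; apply/funext => j; rewrite [RHS]submod_val_sum.
under eq_bigr do rewrite dsum_inclE.
have [js|js] := boolP (j \in s).
  rewrite (bigD1_seq j) //= eqxx big1 ?addr0 // => i /negPf.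
  by rewrite eq_sym => ->.
rewrite -[LHS]/(submod_val (dsum_proj j x)) xs // big_seq big1 // => i si.
by case: eqP js si => // <- /negPf ->.
Qed.

(** The value is a sum over a chosen support, independent of the choice. The additive form serves
    for characters, which are not linear maps. *)
Lemma dsum_additive_copair (N : zmodType)
    (g : forall i, {additive submod (K i) -> N}) :
  exists h : {additive dsum -> N}, forall i v, h (dsum_incl i v) = g i v.
Proof.
have /choice[s sP] (x : dsum) : exists s : seq I,
    uniq s /\ forall i, i \notin s -> dsum_proj i x = 0.
  by have [s] := dsum_support x; exists s.
pose h x := \sum_(i <- s x) g i (dsum_proj i x).
have hE x t : uniq t -> (forall i, i \notin t -> dsum_proj i x = 0) ->
    h x = \sum_(i <- t) g i (dsum_proj i x).
  move=> ut xt; have [us xs] := sP x.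
  apply: eq_big_uniq_support => // i ii; first by rewrite xs // raddf0.
  by rewrite xt // raddf0.
have h_add : zmod_morphism h.
  move=> x y; pose t := undup (s x ++ s y).
  have [ux xs] := sP x; have [uy ys] := sP y.
  have xt i : i \notin t -> dsum_proj i x = 0.
    by rewrite mem_undup mem_cat negb_or => /andP[/xs].
  have yt i : i \notin t -> dsum_proj i y = 0.
    by rewrite mem_undup mem_cat negb_or => /andP[_ /ys].
  rewrite !(hE _ t) ?undup_uniq // -?sumrB.
    by apply: eq_bigr => i _; rewrite linearB raddfB.
  by move=> i it; rewrite linearB xt ?yt // subrr.
exists (additive_of h_add).
move=> i v; rewrite /= (hE _ [:: i]) ?big_seq1 ?dsum_inclK // => j.
by rewrite inE; exact: dsum_proj_incl.
Qed.

Lemma dsum_copair (N : lmodType R) (g : forall i, {linear submod (K i) -> N}) :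
  exists h : {linear dsum -> N}, forall i v, h (dsum_incl i v) = g i v.
Proof.
have [h hE] := dsum_additive_copair g.
have h_lin : linear h.
  move=> r x y; rewrite raddfD; congr (_ + _).
  have [s us xs] := dsum_support x.
  rewrite [in LHS](dsum_decomp us xs) [in RHS](dsum_decomp us xs).
  rewrite scaler_sumr !raddf_sum ?scaler_sumr; apply: eq_bigr => i _.
  by rewrite -[r *: dsum_incl _ _]linearZ !hE [LHS]linearZ.
by exists (linear_of h_lin).
Qed.

(** Induction on a finite list [s] of indices supporting all the [e k]: the component at the head is
    itself a solution, treated in its summand, and the remainder [e'] is supported on the tail. *)
Lemma dsum_eq_flat : (forall i, eq_flat (submod (K i))) -> eq_flat dsum.
Proof.
move=> flK m l S e Se0.
have [s es] : exists s : seq I, forall k i, i \notin s -> dsum_proj i (e k) = 0.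
  have /choice[s sP] k : exists s : seq I, forall i, i \notin s ->
      dsum_proj i (e k) = 0.
    by have [s _] := dsum_support (e k); exists s.
  exists (flatten [seq s k | k <- enum 'I_l]) => k i /flattenP nis.
  apply: sP; apply/negP => isk; apply: nis; exists (s k) => //.
  by apply: map_f; rewrite mem_enum.
elim: s e Se0 es => [|i s IHs] e Se0 es.
  exists 0%N, (fun _ _ => 0), (fun _ => 0); split=> [k|? []//].
  rewrite big_ord0; apply: val_inj; apply/funext => i /=.
  by rewrite -[LHS]/(submod_val (dsum_proj i (e k))) es.
pose e1 k := dsum_proj i (e k); pose e' k := e k - dsum_incl i (e1 k).
have Se1 j : \sum_k S j k *: e1 k = 0 by rewrite -linear_comb Se0 linear0.
have [j|k j js|n' [X' [y' [e'E SX']]]] := IHs e'.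
- under eq_bigr do rewrite scalerBr.
  by rewrite sumrB Se0 -linear_comb Se1 linear0 subrr.
- rewrite linearB; have [->|ji] := eqVneq j i;
    first by rewrite dsum_inclK subrr.
  by rewrite dsum_proj_incl // subr0 es // inE negb_or ji.
have [n1 [X1 [y1 [e1E SX1]]]] := flK i _ _ S e1 Se1.
exists (n1 + n')%N, (fun k => cat_fun (X1 k) (X' k)),
  (cat_fun (fun t => dsum_incl i (y1 t)) y'); split=> [k|j t].
  rewrite big_split_ord -[LHS](subrK (dsum_incl i (e1 k))) [LHS]addrC.
  congr (_ + _).
    rewrite e1E linear_comb. apply: eq_bigr => t _.
    by rewrite !cat_funl.
  by rewrite -[LHS]/(e' k) e'E; apply: eq_bigr => t _; rewrite !cat_funr.
rewrite -[t]splitK; case: (fintype.split t) => {}t /=.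
  by under eq_bigr do rewrite cat_funl; exact: SX1.
by under eq_bigr do rewrite cat_funr; exact: SX'.
Qed.

End DirectSum.

(** * Free modules and FP-injectivity *)

Section FreeModule.
Variables (R : pzRingType) (J : choiceType).

Fact full_submod (M : lmodType R) : is_submod (fun _ : M => True).
Proof. by []. Qed.

Let K (_ : J) : submodClosed R^o := submod_of (full_submod R^o).

Definition free_module : lmodType R := dsum K.

Definition free_coord (x : free_module) (j : J) : R := submod_val x j.

Definition free_scalar j (r : R) : submod (K j) :=
  Submod (introT (submod_ofP (full_submod R^o) r) I).

Definition free_basis (j : J) : free_module := dsum_incl K j (free_scalar j 1).

Lemma free_incl (j : J) (v : submod (K j)) :
  dsum_incl K j v = (submod_val v : R) *: free_basis j.
Proof.
rewrite -linearZ; congr (dsum_incl K j _); apply: val_inj => /=.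
by rewrite -[RHS]/(_ * _) mulr1.
Qed.

Lemma free_decomp (x : free_module) (s : seq J) :
  uniq s -> (forall j, j \notin s -> free_coord x j = 0) ->
  x = \sum_(j <- s) free_coord x j *: free_basis j.
Proof.
move=> us xs; rewrite [LHS](dsum_decomp us); last by move=> j /xs ?;
  apply: val_inj.
by apply: eq_bigr => j _; rewrite free_incl.
Qed.

Lemma free_support (x : free_module) :
  exists2 s : seq J, uniq s & forall j, j \notin s -> free_coord x j = 0.
Proof.
have [s us xs] := dsum_support x; exists s => // j /xs.
by move/(congr1 (@submod_val _ _ _)).
Qed.

Lemma free_additive_copair (N : zmodType) (g : J -> {additive R -> N}) :
  exists h : {additive free_module ->
    N}, forall j r, h (r *: free_basis j) = g j r.
Proof.
have g_add j : zmod_morphism (fun v : submod (K j) => g j (submod_val v)).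
  by move=> v w; rewrite -raddfB.
have [h hE] := dsum_additive_copair (fun j => additive_of (g_add j)).
by exists h => j r; rewrite -(free_incl (free_scalar j r)) hE.
Qed.

Lemma free_linear_copair (N : lmodType R) (b : J -> N) :
  exists h : {linear free_module -> N}, forall j, h (free_basis j) = b j.
Proof.
have g_lin j : linear (fun v : submod (K j) => (submod_val v : R) *: b j).
  by move=> r v w; rewrite -[submod_val _]/(r * submod_val v + submod_val w)
    scalerDl scalerA.
have [h hE] := dsum_copair (fun j => linear_of (g_lin j)).
by exists h => j; rewrite hE /= scale1r.
Qed.

Lemma free_projective : projective_module free_module.
Proof.
move=> B C p /choice[s sK] f.
have [h hE] := free_linear_copair (fun j => s (f (free_basis j))).
exists h => x; have [t ut xt] := free_support x.
rewrite (free_decomp ut xt) !linear_sum; apply: eq_bigr => j _.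
by rewrite /= !linearZ /= hE sK.
Qed.

End FreeModule.

(** * Free right modules: flatness and characters *)

Section FreeRight.
Variables (R : pzRingType) (J : choiceType).
Let X := free_module R^c J.

(** Each coordinate of [X] gives a balanced map, so the coordinates of a tensor that dies over [B]
    vanish in [B], hence in [A]; the tensor is recovered from them and the basis. *)
Lemma free_flat_right : flat_right X.
Proof.
move=> A B i i_inj.
suff h0 u : tensor_map (idfun : {linear X -> X}) i u = 0 -> u = 0.
  exact: raddf_inj.
rewrite -[u]reprK; move: (repr u) => s {u}; rewrite tensor_mapE => s0.
have s0' j : \sum_(p <- s) (free_coord p.1 j : R) *: p.2 = 0.
  have b_bal : balanced (fun (x : X) (b : B) => (free_coord x j : R) *: b).
    split=> [x y b|x b b'|r x b].
    - by rewrite -scalerDl.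
    - by rewrite scalerDr.
    - by rewrite scalerA.
  have [f fE _] := tensor_universal b_bal.
  apply: i_inj; rewrite linear0 linear_sum; move/(congr1 f): s0.
  rewrite raddf0 tensor_sumE raddf_sum big_map => {2}<-.
  by apply: eq_bigr => p _; rewrite fE linearZ.
have [t ut st] : exists2 t : seq J, uniq t &
    forall p, p \in s -> forall j, j \notin t -> free_coord p.1 j = 0.
  have /choice[t tP] (x : X) : exists t : seq J, forall j, j \notin t ->
      free_coord x j = 0.
    by have [t _] := free_support x; exists t.
  exists (undup (flatten [seq t p.1 | p <- s])); first exact: undup_uniq.
  move=> p ps j; rewrite mem_undup => /flattenP nj; apply: tP.
  apply/negP => jt; apply: nj; exists (t p.1) => //.
  by apply/mapP; exists p.
rewrite tensor_sumE big_seq.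
rewrite (eq_bigr (fun p : X * A => \sum_(j <- t)
    pure_tensor (free_basis R^c j) ((free_coord p.1 j : R) *: p.2))).
  rewrite -big_seq exchange_big big1 // => j _.
  by rewrite -pure_tensor_sumr s0' pure_tensor0r.
move=> p ps; rewrite [in LHS](free_decomp ut (st _ ps)) pure_tensor_suml.
by apply: eq_bigr => j _; rewrite pure_tensorZ.
Qed.

(** Characters of a direct sum form the product of the character modules of its summands: [r]
    restricts a character to the multiples of each basis element, and it is bijective. *)
Lemma reg_char_power_retract :
  exists (i : {linear (J -> reg_char R) -> char_module X})
    (r : {linear char_module X -> (J -> reg_char R)}), forall x, r (i x) = x.
Proof.
have r_proof (chi : char_module X) j :
    (fun c : (R^c)^o => chi ((c : R^c) *: free_basis R^c j))
      \in @char_pred R (R^c)^o.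
  by apply/asboolP => c d; rewrite scalerDl char_valD.
have r_lin : linear (fun chi j => CharModule (r_proof chi j) : reg_char R).
  move=> c chi chi'; apply/funext => j; apply: char_moduleP => d /=.
  by rewrite -[LHS]/(chi ((c : R^c) *: _) + chi' _) scalerA.
pose r := linear_of r_lin.
have chi0 (chi : char_module X) : chi 0 = 0.
  by apply: (addrI (chi 0)); rewrite -char_valD !addr0.
have chi_sum (chi : char_module X) (t : seq J) (F : J -> X) :
    chi (\sum_(j <- t) F j) = \sum_(j <- t) chi (F j).
  elim: t => [|j t IHt]; first by rewrite !big_nil.
  by rewrite !big_cons char_valD IHt.
have r_inj : injective r.
  move=> chi chi' rE; apply: char_moduleP => x.
  have [t ut xt] := free_support x; rewrite (free_decomp ut xt) !chi_sum.
  apply: eq_bigr => j _.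
  exact: (congr1 (fun th : J -> reg_char R => th j (free_coord x j)) rE).
have r_surj (th : J -> reg_char R) : exists chi, r chi = th.
  have th_add j : zmod_morphism (fun c : R^c => th j c).
    move=> c d; rewrite -[c in RHS](subrK d) -[RHS]/(th j (c - d + d) - th j d).
    by rewrite (char_valD (th j) (c - d) d) addrK.
  have [h hE] := free_additive_copair (fun j => additive_of (th_add j)).
  exists (CharModule (char_of_additive h)).
  by apply/funext => j; apply: char_moduleP => c; exact: hE.
have [i iE] := linear_lift (f :=
    (idfun : {linear (J -> reg_char R) -> _})) r_inj r_surj.
by exists i, r.
Qed.

End FreeRight.

(** * Injective, FP-injective and pure submodules *)

Section FPInjective.
Variable R : pzRingType.

Lemma rowmx_fp m l (S : 'I_m -> 'I_l -> R) : exists (P : lmodType R)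
  (d : {linear 'rV[R]_m -> 'rV[R]_l}) (p : {linear 'rV[R]_l -> P}),
  [/\ forall j, d (delta_mx 0 j) = \row_k S j k,
    exact_at d p & surjective_map p].
Proof.
pose d := rowlin (fun j => \row_k S j k).
exists (quotmod (lin_image d)), d, (quotmod_proj _); split.
- by move=> j; exact: rowlin_delta.
- move=> v; split=> [/quotmod_proj_eq0/submod_ofP//|dv].
  exact/quotmod_proj_eq0/submod_ofP.
- exact: quotmod_proj_surj.
Qed.

(** By exactness [f] factors through the image of [d1], a submodule of [P0], from which it
    extends. *)
Lemma injective_FP_injective (N : lmodType R) : injective_module N ->
    FP_injective N.
Proof.
move=> injN F _ P2 P1 P0 d2 d1 e _ _ _ d21 _ _ f fd2.
have [d' d'E d'_surj] := image_factor d1.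
have [x d'x|g gE] := linear_factor (q := f) d'_surj.
  by have /d21[y <-] : d1 x = 0 by rewrite -d'E d'x linear0.
have [h hE] := injN _ _ _ (@submod_incl_inj R _ (lin_image d1)) g.
by exists h => x; rewrite /= -d'E [LHS]hE gE.
Qed.

(** Let [P] be presented by [S]. Sending the [j]-th basis row to the [j]-th constant is a cocycle
    with values in [N]; extending it along [d] gives a map [h] whose values on the basis solve the
    system in [N]. *)
Lemma FP_injective_eq_pure (E : lmodType R) (N : submodClosed E) :
  FP_injective (submod N) -> eq_pure (fun x => x \in N).
Proof.
move=> fpN m l S b SbN.
have [P [d [p [dE dp p_surj]]]] := rowmx_fp S.
have fpP : finitely_presented P by exists m, l, d, p.
(* The resolution is continued by the free module on all elements of the kernel of [d]. *)
pose K : choiceType := {classic {w : 'rV[R]_m | d w = 0}}.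
have [d2 d2E] := free_linear_copair (fun w : K => sval w).
have ex2 : exact_at d2 d.
  move=> w; split=> [dw0|[x <-]].
    by exists (free_basis R (exist _ w dw0 : K)); rewrite d2E.
  have [t ut xt] := free_support x; rewrite (free_decomp ut xt) !linear_sum.
  rewrite big1 // => j _; rewrite !linearZ /= d2E.
  by rewrite (svalP j) scaler0.
pose f := rowlin (fun j => Submod (SbN j) : submod N).
have dwE w : d w = \sum_j w 0 j *: \row_k S j k.
  by rewrite linear_rowE; apply: eq_bigr => j _; rewrite dE.
have fE w : submod_incl N (f w) = rowlin b (d w).
  rewrite [f w]rowlinE linear_comb dwE linear_comb; apply: eq_bigr => j _.
  by congr (_ *: _); rewrite rowlinE; apply: eq_bigr => k _; rewrite mxE.
have fd2 x : f (d2 x) = 0.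
  apply: submod_incl_inj; rewrite fE (proj2 (ex2 (d2 x))) ?linear0 //.
  by exists x.
have [h hE] := fpN P fpP _ _ _ d2 d p (@free_projective R K) (@row_projective
    R m)
  (@row_projective R l) ex2 dp p_surj f fd2.
exists (fun k => submod_incl N (h (delta_mx 0 k))); split=> [k|j];
  first exact: valP.
have : h (d (delta_mx 0 j)) =
    Submod (SbN j) by rewrite [LHS]hE [LHS]rowlin_delta.
rewrite dE linear_rowE => /(congr1 (submod_incl N)); rewrite linear_comb => jE.
rewrite -[RHS]/(submod_incl N (Submod (SbN j))) -jE.
by apply: eq_bigr => k _; rewrite mxE.
Qed.

End FPInjective.

(** * Flat precovers *)

Section Precover.
Variable R : pzRingType.
Implicit Types M N Y : lmodType R.

Definition pick_or (T : Type) (x0 : T) (P : T -> Prop) : T :=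
  if pselect (exists x, P x) is left ex then sval (cid ex) else x0.

Lemma pick_orP T (x0 : T) (P : T -> Prop) : (exists x, P x) -> P (pick_or x0 P).
Proof. by rewrite /pick_or; case: pselect => // ex _; case: (cid ex). Qed.

(* Terms for the elements of the least submodule that contains a given element
   and a chosen solution of every solvable system with constants in it; the
   solution has index [k] in [PSol S c k]. *)
Inductive ptree : Type :=
| PLeaf
| PComb of R & ptree & ptree
| PSol m l of ('I_m -> 'I_l -> R) & ('I_m -> ptree) & 'I_l.

Fixpoint peval Y (y : Y) (t : ptree) : Y :=
  match t with
  | PLeaf => y
  | PComb r t u => r *: peval y t + peval y u
  | PSol m l A c k => pick_or (fun _ => 0)
      (fun x : 'I_l -> Y => forall j, \sum_k A j k *: x k = peval y (c j)) k
  end.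

Lemma peval_submod Y (y : Y) : is_submod (fun z => exists t, peval y t = z).
Proof.
split=> [|r _ _ [t <-] [u <-]]; last by exists (PComb r t u).
by exists (PComb (-1) PLeaf PLeaf); rewrite /= scaleN1r addNr.
Qed.

(** [PSol] names a solution as soon as the constants have names; [b] only ensures that one
    exists. *)
Lemma peval_eq_pure Y (y : Y) : eq_pure (fun z => exists t, peval y t = z).
Proof.
move=> m l S b /choice[c cE].
exists (fun k => peval y (PSol S c k)); split=> [k|j];
  first by exists (PSol S c k).
rewrite -cE; apply: (@pick_orP _ (fun _ => 0) (fun x : 'I_l -> Y =>
  forall j, \sum_k S j k *: x k = peval y (c j))).
by exists b => j'; rewrite cE.
Qed.

Definition comb M (q : ptree -> M) (w : seq (R * ptree)) : M :=
  \sum_(p <- w) p.1 *: q p.2.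

Lemma comb_lin M (q : ptree -> M) r w w' :
  comb q ([seq (r * p.1, p.2) | p <- w] ++ w') = r *: comb q w + comb q w'.
Proof.
rewrite /comb big_cat big_map scaler_sumr /=; congr (_ + _).
by apply: eq_bigr => p _; rewrite scalerA.
Qed.

Lemma comb_linear M N (f : {linear M ->
    N}) q w : f (comb q w) = comb (f \o q) w.
Proof. by rewrite linear_sum; apply: eq_bigr => p _; rewrite linearZ. Qed.

Lemma combB M (q q' : ptree -> M) w :
  comb (fun t => q t - q' t) w = comb q w - comb q' w.
Proof. by rewrite -sumrB; apply: eq_bigr => p _; rewrite scalerBr. Qed.

Lemma comb_in M (P : M -> Prop) (q : ptree -> M) w :
  is_submod P -> (forall t, P (q t)) -> P (comb q w).
Proof.
move=> [P0 PD] Pq; rewrite /comb; elim: w => [|p w IHw];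
  first by rewrite big_nil.
by rewrite big_cons; exact: PD.
Qed.

(* Terms for the elements of a submodule closed under solving, for maps
   [q : ptree -> M], conditions prescribing [f \o q] and the values in the
   submodule of some formal linear combinations of [q].  The type does not
   depend on [M]. *)
Inductive mtree N : Type :=
| MZero
| MComb of R & mtree N & mtree N
| MSol of (seq (R * ptree) -> Prop) & (ptree -> N) &
    (seq (R * ptree) -> mtree N) & ptree.

Section Eval.
Variables (M N : lmodType R) (f : {linear M -> N}).

Fixpoint meval (t : mtree N) : M :=
  match t with
  | MZero => 0
  | MComb r t u => r *: meval t + meval u
  | MSol U nu a t => pick_or (fun _ => 0) (fun q : ptree -> M =>
      (forall w, U w -> comb q w = meval (a w)) /\ (forall t, f (q t) = nu t)) t
  end.

Lemma meval_submod : is_submod (fun x => exists t, meval t = x).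
Proof.
by split=> [|r _ _ [t <-] [u <-]]; [exists (MZero N) | exists (MComb r t u)].
Qed.

(* If [x] is not a value of [meval], take [e : ptree -> M] lifting a small pure
   submodule of [M] modulo the values that contains the class of [x].  The
   closure property yields [q] among the values with [f \o q = f \o e] that
   agrees with [e] on all combinations landing in the values; the span of
   [e - q] is then pure, killed by [f] and nonzero. *)
Lemma meval_surj :
  (forall P : M -> Prop, is_submod P -> eq_pure P ->
    (forall x, P x -> f x = 0) -> forall x, P x -> x = 0) ->
  surjective_map meval.
Proof.
move=> noP x; apply: contrapT => nx.
pose M0 := submod_of meval_submod; pose pr := quotmod_proj M0.
have pr0 z : pr z = 0 <-> exists t, meval t = z.
  by split=> [/quotmod_proj_eq0/submod_ofP|zM]//;
    apply/quotmod_proj_eq0/submod_ofP.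
pose y := pr x.
have /choice[e eE] t := quotmod_proj_surj (peval y t : quotmod M0).
(* [a w] names [comb e w] whenever this is a value of [meval]; [MZero] is a filler for the other
   [w]. *)
have /choice[a aE] w : exists t, (exists t', meval t' = comb e w) ->
    meval t = comb e w.
  have [[t tE]|no] := pselect (exists t', meval t' = comb e w);
      first by exists t.
  by exists (MZero N).
pose U w := exists t, meval t = comb e w.
pose q t := meval (MSol U (f \o e) a t).
have [qU fq] : (forall w, U w ->
    comb q w = meval (a w)) /\ (forall t, f (q t) = f (e t)).
  apply: (@pick_orP _ (fun _ => 0) (fun q : ptree -> M => (forall w, U w ->
    comb q w = meval (a w)) /\
    (forall t, f (q t) = (f \o e) t))).
  by exists e; split=> // w /aE.
pose P z := exists w, comb (fun t => e t - q t) w = z.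
have Psub : is_submod P.
  split=> [|r _ _ [w <-] [w' <-]]; first by exists [::]; rewrite /comb big_nil.
  by exists ([seq (r * p.1, p.2) | p <- w] ++ w'); rewrite comb_lin.
have prq t : pr (q t) = 0 by apply/pr0; eexists.
(* [pr] is injective on [P]: a combination of [e] that is a value of [meval] is matched exactly by
   [q]. *)
have prP z : P z -> pr z = 0 -> z = 0.
  move=> [w <-]; rewrite combB linearB.
  have -> : pr (comb q w) = 0.
    by apply/pr0; apply: comb_in meval_submod _ => t; eexists.
  by rewrite subr0 => /pr0 wU; rewrite qU // aE // subrr.
have prPQ z : P z -> exists t, peval y t = pr z.
  move=> [w <-]; rewrite comb_linear; apply: comb_in (peval_submod y) _ => t.
  by exists t; rewrite -[RHS]/(pr (e t - q t)) linearB prq subr0 [pr (e _)]eE.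
have Pgen t : P (e t - q t) by exists [:: (1, t)];
    rewrite /comb big_seq1 scale1r.
(* [pr] identifies [P] with the values of [peval y], and purity is carried back along this
   identification. *)
have x0 : e PLeaf - q PLeaf = 0.
  apply: (noP P) => // [m l S b SbP|_ [w <-]]; last first.
    rewrite comb_linear /comb big1 // => p _; rewrite /= linearB fq subrr.
    exact: scaler0.
  have [j|c [cQ cE]] := peval_eq_pure (y := y) (S := S) (b :=
      fun k => pr (b k)).
    by rewrite -linear_comb; exact: prPQ.
  have [t tE] := choice cQ.
  exists (fun k => e (t k) - q (t k)); split=> [k|j]; first exact: Pgen.
  apply/eqP; rewrite -subr_eq0; apply/eqP/prP; last first.
    rewrite linearB (linear_comb pr) (linear_comb pr) -cE -sumrB big1 // => k _.
    by rewrite linearB prq subr0 [pr (e _)]eE tE subrr.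
  have PB u v : P u -> P v -> P (u - v).
    by move=> Pu Pv; rewrite addrC -scaleN1r; exact: Psub.2.
  apply: PB => //; elim/big_ind: _ => [|u v Pu Pv|k _]; first exact: Psub.1.
    by rewrite -[u]scale1r; exact: Psub.2.
  by rewrite -[_ *: _]addr0; apply: Psub.2; [exact: Pgen | exact: Psub.1].
apply: nx; apply/pr0; have := congr1 pr x0.
by rewrite linearB prq subr0 linear0 [pr (e _)]eE.
Qed.

End Eval.

(** Lift a solution [c] in [P] to [u]. The system then has constants in the kernel at [b - u], and a
    solution [a] of it in the kernel corrects [u] to [u + a]. *)
Lemma eq_pure_quotient M N (p : {linear M -> N}) (P : N -> Prop) :
  surjective_map p -> is_submod P -> eq_pure (fun x => p x = 0) -> eq_pure P ->
  eq_pure (fun x => P (p x)).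
Proof.
move=> p_surj Psub pur purP m l S b SbP.
have [j|c [cP cE]] := purP _ _ S (fun k => p (b k)).
  by rewrite -linear_comb; exact: SbP.
have /choice[u uE] k := p_surj (c k).
have [j|a [a0 aE]] := pur _ _ S (fun k => b k - u k).
  rewrite linear_comb; under eq_bigr do rewrite linearB uE scalerBr.
  by rewrite sumrB cE subrr.
exists (fun k => u k + a k); split=> [k|j];
  first by rewrite linearD a0 addr0 uE.
under eq_bigr do rewrite scalerDr.
rewrite big_split /= aE -big_split /=; apply: eq_bigr => k _.
by rewrite -scalerDr addrC subrK.
Qed.

(** Zorn's lemma applies because a system has finitely many constants: those taken from the union of
    a chain lie in a single member ([Fall]). *)
Lemma max_pure_submod M (K : M -> Prop) : K 0 -> exists P : M -> Prop,
  [/\ is_submod P, eq_pure P, (forall x, P x -> K x) &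
    forall Q : M -> Prop, is_submod Q -> eq_pure Q -> (forall x, Q x -> K x) ->
      (forall x, P x -> Q x) -> forall x, Q x -> P x].
Proof.
move=> K0.
pose good := [set P : set M | [/\ is_submod P, eq_pure P & P `<=` K]].
have [||P [_ [Psub Ppure PK] Pmax]] := @Zorn_above M good [set 0].
- split; last by move=> _ ->.
    by split=> [//|r x y -> ->]; rewrite scaler0 addr0.
  move=> m l S b Sb0; exists (fun _ => 0); split=> // j.
  by rewrite [RHS]Sb0 big1 // => k _; rewrite scaler0.
- move=> F [A0 FA0] Ftot Fgood.
  have Fsub A : F A -> is_submod A by move=> /Fgood[_ []].
  have Fall m (a : 'I_m -> M) : (forall j, (\bigcup_(X in F) X) (a j)) ->
      exists2 A, F A & forall j, A (a j).
    elim: m a => [|m IHm] a aF; first by exists A0 => // -[].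
    have [A FA Aa] := IHm (fun j => a (lift ord0 j)) (fun j => aF _).
    have [B FB Ba] := aF ord0.
    have [AB|BA] := Ftot _ _ FA FB.
      exists B => // j; case: (unliftP ord0 j) => [i|] -> //; exact: AB.
    exists A => // j; case: (unliftP ord0 j) => [i|] -> //; exact: BA.
  split.
  + split=> [|r x y xF yF]; first by exists A0 => //; exact: (Fsub _ FA0).1.
    have [j|A FA Axy] := Fall 2%N (fun j => if j == ord0 then x else y).
      by case: ifP.
    exists A => //; apply: (Fsub _ FA).2;
      [exact: (Axy ord0)|exact: (Axy (lift ord0 ord0))].
  + move=> m l S b SbF; have [A FA Ab] := Fall _ _ SbF.
    have [_ [_ Apure _]] := Fgood _ FA.
    by have [a [aA aE]] := Apure _ _ S b Ab; exists a; split=> // k; exists A.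
  + by move=> x [A FA Ax]; have [_ [_ _]] := Fgood _ FA; apply.
exists P; split=> // Q Qsub Qpure QK PQ x Qx.
by apply: (Pmax Q) => //.
Qed.

Theorem flat_precover_exists N :
  exists (G : lmodType R) (g : {linear G -> N}), flat_precover g.
Proof.
pose V := cogenerator R (mtree N).
(* The indices are all the flat submodules of [V] equipped with a map to [N]. *)
pose I : choiceType := {classic {K : submodClosed V &
  {g : {linear submod K -> N} | flat (submod K)}}}.
pose K (i : I) : submodClosed V := projT1 i.
have [g gE] := dsum_copair (fun i : I =>
  sval (projT2 i) : {linear submod (K i) -> N}).
exists (dsum K), g; split.
  by apply/eq_flat_flat/dsum_eq_flat => -[L [g' flL]]; exact: flat_eq_flat.
move=> F' flF' f.
have [P [Psub Ppure Pf Pmax]] := max_pure_submod (K :=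
    fun x => f x = 0) (linear0 f).
pose pr := quotmod_proj (submod_of Psub).
have pr0 x : pr x = 0 <-> P x.
  by split=> [/quotmod_proj_eq0/submod_ofP|Px]//;
    apply/quotmod_proj_eq0/submod_ofP.
have pr_surj : surjective_map pr by exact: quotmod_proj_surj.
have [x /pr0/Pf//|f' f'E] := linear_factor (q := f) pr_surj.
have prpure : eq_pure (fun x => pr x = 0).
  by have -> : (fun x => pr x = 0) = P by apply/funext => x; apply/propext/pr0.
have flF : eq_flat (quotmod (submod_of Psub)).
  exact: eq_flat_pure_quotient pr_surj (flat_eq_flat flF') prpure.
have e_surj : surjective_map (meval f').
  apply: meval_surj => Q Qsub Qpure Qf' z.
  have [x <-] := pr_surj z => Qx; apply/pr0.
  (* The preimage of [Q] is pure, killed by [f] and contains [P], so maximality applies. *)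
  apply: (Pmax (fun x => Q (pr x))) => //.
  - by split=> [|r u v Qu Qv]; rewrite ?linear0 ?linearP;
      [exact: Qsub.1|exact: Qsub.2].
  - exact: eq_pure_quotient.
  - by move=> u /Qf'; rewrite f'E.
  - by move=> u /pr0 ->; exact: Qsub.1.
have [i i_inj] := embed_cogenerator e_surj.
have [d dE d_surj] := image_factor i.
have [u du|r rE] := linear_factor (q := idfun) d_surj.
  by apply: i_inj; rewrite -dE du !linear0.
have drK v : d (r v) = v by have [u <-] := d_surj v; rewrite rE.
have flim : flat (submod (lin_image i)).
  by apply: eq_flat_flat; exact: eq_flat_retract drK flF.
(* The image of [i], with [f'] transported to it, is one of the summands, and [f] factors through
   it. *)
pose j : I := existT _ (lin_image i) (exist _ (f' \o r : {linear _ -> _}) flim).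
exists (dsum_incl K j \o (d \o pr) : {linear _ -> _}) => x.
by rewrite /= gE /= rE f'E.
Qed.

End Precover.

(** * IF-rings *)

Section IFRings.
Variable R : pzRingType.
Implicit Types M N P : lmodType R.

(** A solution [e] in [N] is a map out of the module presented by [S], whose generators [x] are the
    universal solution. *)
Lemma fp_map_of_relations N m l (S : 'I_m -> 'I_l -> R) (e : 'I_l -> N) :
  (forall j, \sum_k S j k *: e k = 0) ->
  exists (P : lmodType R) (x : 'I_l -> P) (phi : {linear P -> N}),
    [/\ finitely_presented P, forall y, exists c : 'I_l ->
      R, \sum_k c k *: x k = y,
        forall j, \sum_k S j k *: x k = 0 & forall k, phi (x k) = e k].
Proof.
move=> Se0; have [P [d [p [dE dp p_surj]]]] := rowmx_fp S.
have [v /dp[w <-]|phi phiE] := linear_factor (q := rowlin e) p_surj.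
  rewrite (linear_rowE d) linear_comb big1 // => j _.
  rewrite dE rowlinE; under eq_bigr do rewrite mxE.
  by rewrite Se0 scaler0.
exists P, (fun k => p (delta_mx 0 k)), phi; split.
- by exists m, l, d, p.
- by move=> y; have [v <-] := p_surj y; exists (v 0); rewrite -linear_rowE.
- move=> j; have : p (d (delta_mx 0 j)) = 0 by apply/dp; eexists.
  rewrite dE linear_rowE => {2}<-; apply: eq_bigr => k _.
  by rewrite mxE.
- by move=> k; rewrite phiE rowlin_delta.
Qed.

Lemma IF_embeds_in_flat : IF_ring R -> forall M, embeds_in_flat M.
Proof.
move=> ifR M; have [E [i [injE i_inj]]] := embeds_in_injective M.
by exists E, i; split=> //; exact: ifR.
Qed.

Lemma fp_embeds_in_flat_IF :
  (forall M, finitely_presented M -> embeds_in_flat M) -> IF_ring R.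
Proof.
move=> emb E injE; apply: eq_flat_flat => m l S e Se0.
have [P [x [phi [fpP _ Sx0 phiE]]]] := fp_map_of_relations Se0.
have [F [i [flF i_inj]]] := emb P fpP.
have [h hE] := injE _ _ i i_inj phi.
have [j|n [X [y [yE SX]]]] := flat_eq_flat flF (S := S) (e := fun k => i (x k)).
  by rewrite -linear_comb Sx0 linear0.
exists n, X, (fun t => h (y t)); split=> // k.
by rewrite -linear_comb -yE -phiE -hE.
Qed.

Lemma IF_char_flat : IF_ring R ->
  forall F : lmodType R^c, flat_right F -> flat (char_module F).
Proof. by move=> ifR F /flat_right_char_injective; exact: ifR. Qed.

(** By injectivity [E] is a retract of [cogenerator R E], a power of [reg_char R], which is a
    retract of the character module of a free right module. *)
Lemma char_flat_IF :
  (forall F : lmodType R^c, flat_right F -> flat (char_module F)) -> IF_ring R.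
Proof.
move=> chfl E injE.
have [|i i_inj] := @embed_cogenerator R E E id; first by move=> x; exists x.
have [r rK] := injE _ _ i i_inj idfun.
have [i' [r' r'K]] := reg_char_power_retract R {classic E -> QmodZ}.
apply/eq_flat_flat/(eq_flat_retract rK)/(eq_flat_retract r'K).
exact/flat_eq_flat/chfl/free_flat_right.
Qed.

Lemma IF_FP_injective_quotient (E : lmodType R) (N : submodClosed E) :
  IF_ring R -> injective_module E -> FP_injective (submod N) ->
    flat (quotmod N).
Proof.
move=> ifR /ifR flE fpN; apply: eq_flat_flat; apply: eq_flat_quot.
  exact: flat_eq_flat.
exact: FP_injective_eq_pure.
Qed.

(** The hypothesis is applied to the zero submodule, which is injective and whose quotient is [E]
    itself. *)
Lemma injective_quotient_IF :
  (forall (E : lmodType R) (N : submodClosed E),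
    injective_module E -> injective_module (submod N) -> flat (quotmod N)) ->
  IF_ring R.
Proof.
move=> quofl E injE.
have sub0 : is_submod (fun x : E => x = 0).
  by split=> // r x y -> ->; rewrite scaler0 addr0.
have fl : flat (quotmod (submod_of sub0)).
  apply: quofl => // A B i i_inj f; exists (\0 : {linear B -> _}) => a.
  by apply: val_inj; case: (f a) => y y0 /=; have /submod_ofP := y0.
have [x|h hE] := linear_factor (q := (idfun : {linear E -> E}))
    (@quotmod_proj_surj R E (submod_of sub0)).
  by move=> /quotmod_proj_eq0/submod_ofP.
by apply: eq_flat_flat; exact: eq_flat_retract hE (flat_eq_flat fl).
Qed.

(** The sum of all submodules of [V] has every finitely generated module as a summand, up to
    isomorphism. If [N] is in its domain, every map from a finitely presented module to [N]
    therefore lifts to a flat precover of [N], and [N] is flat. *)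
Lemma f_rugged_exists : exists M, f_rugged M.
Proof.
pose V := cogenerator R (nat -> R).
pose K (i : {classic submodClosed V}) : submodClosed V := i.
exists (dsum K) => N; split=> [dom|flN f F g [_ cov]]; last first.
  have [s sK] := cov N flN idfun.
  by exists (s \o f : {linear _ -> _}) => x; exact: sK.
(* Without a precover of [N], membership in the domain would hold vacuously. *)
have [G [g gcov]] := flat_precover_exists N; have [flG _] := gcov.
apply: eq_flat_flat => m l S e Se0.
have [P [x [phi [_ x_gen Sx0 phiE]]]] := fp_map_of_relations Se0.
have [|i i_inj] := @embed_cogenerator R (nat ->
    R) P (fun c => \sum_(k < l) c k *: x k).
  move=> y; have [c <-] := x_gen y.
  (* Coefficients are padded by 0 to sequences, so that [V] does not depend on the number [l] of
     generators. *)
  exists (fun n => if insub n is Some k then c k else 0).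
  by apply: eq_bigr => k _; rewrite valK.
have [d dE d_surj] := image_factor i.
have [u du|r rE] := linear_factor (q := idfun) d_surj.
  by apply: i_inj; rewrite -dE du !linear0.
pose L : {classic submodClosed V} := lin_image i.
have [h hE] := dom (phi \o (r \o dsum_proj K L) : {linear _ -> _}) G g gcov.
pose j := (h \o (dsum_incl K L \o d) : {linear P -> G}).
have gj u : g (j u) = phi u.
  by rewrite -[LHS]/((g \o h) _) hE /= -[X in phi (r X)]/(dsum_proj K L
    (dsum_incl K L (d u))) dsum_inclK rE.
have [j0|n [X [y [yE SX]]]] := flat_eq_flat flG (S := S) (e :=
    fun k => j (x k)).
  by rewrite -linear_comb Sx0 linear0.
exists n, X, (fun t => g (y t)); split=> // k.
by rewrite -linear_comb -yE gj phiE.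
Qed.

(** Every injective [E] is in the domain of [M]: a map from [M] to [E] extends to the flat module
    [F], and from there lifts through any flat precover. *)
Lemma f_rugged_embeds_IF : (exists M, f_rugged M /\ embeds_in_flat M) ->
    IF_ring R.
Proof.
move=> [M [rugM [F [i [flF i_inj]]]]] E injE.
apply/(rugM E) => f G g [_ cov].
have [f' f'E] := injE _ _ i i_inj f.
have [h hE] := cov F flF f'.
by exists (h \o i : {linear _ -> _}) => x;
  rewrite /= -[LHS]/((g \o h) _) hE -f'E.
Qed.

End IFRings.

Theorem corollary4p8 (R : pzRingType) :
  [<->
    IF_ring R;
    forall M : lmodType R, embeds_in_flat M;
    forall M : lmodType R, pure_projective M -> embeds_in_flat M;
    forall M : lmodType R, finitely_presented M -> embeds_in_flat M;
    forall F : lmodType R^c, flat_right F -> flat (char_module F);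
    forall (E : lmodType R) (N : submodClosed E),
      injective_module E -> injective_module (submod N) -> flat (quotmod N);
    forall (E : lmodType R) (N : submodClosed E),
      injective_module E -> FP_injective (submod N) -> flat (quotmod N);
    exists M : lmodType R, f_rugged M /\ embeds_in_flat M].
Proof.
have IF6 : IF_ring R -> forall (E : lmodType R) (N : submodClosed E),
    injective_module E -> injective_module (submod N) -> flat (quotmod N).
  move=> ifR E N injE /injective_FP_injective.
  exact: IF_FP_injective_quotient.
(* From the implication out of finitely presented modules on, each one passes through
   [IF_ring R]. *)
tfae.
- exact: IF_embeds_in_flat.
- by move=> emb M _; exact: emb.
- by move=> emb M /finitely_presented_pure_projective; exact: emb.
- by move=> /fp_embeds_in_flat_IF; exact: IF_char_flat.
- by move=> /char_flat_IF; exact: IF6.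
- move=> /injective_quotient_IF ifR E N; exact: IF_FP_injective_quotient.
- move=> quo; have ifR : IF_ring R.
    apply: injective_quotient_IF => E N injE /injective_FP_injective.
    exact: quo.
  have [M rugM] := f_rugged_exists R; exists M; split=> //.
  exact: IF_embeds_in_flat.
- exact: f_rugged_embeds_IF.
Qed.
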